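(* Let $P$ be the three-dimensional polytope with nine vertices $0,1,\dots,7,c$ whose graph is the planar graph obtained from the octagon with vertices $0,1,\dots,7$ in cyclic order by adding a vertex $c$ at the centre joined by edges to $1,3,5,7$, and adding on the outside the edges $\{0,2\},\{2,4\},\{4,6\},\{6,0\}$. Then the family of subsets $$\{0,1,2\},\ \{2,3,4\},\ \{4,5,6\},\ \{6,7,0\},\ \{c,1,3\},\ \{c,3,5\},\ \{c,5,7\},\ \{c,7,1\},\ \{1,2,3\},\ \{3,4,5\}$$ is a maximal family in $\mathrm{CM}_*(P)$.
   Context: $P$ is regarded as a regular cell complex consisting of all its faces, including itself; its 2-faces are the quadrangles with vertex sets $\{c,1,2,3\},\{c,3,4,5\},\{c,5,6,7\},\{c,7,0,1\},\{0,2,4,6\}$ and the triangles $\{0,1,2\},\{2,3,4\},\{4,5,6\},\{6,7,0\}$. Let $U$ be its vertex set. Fix a field $k$; $\mathbb N$ contains $0$. Identify $k[x_1,\dots,x_r]$ with $k[\mathbb N^r]$. An object of $\mathrm{CM}(P)$ is a pair $(\mathbb N^r,\mathbf a)$ with $\mathbf a=(\mathbf a_u)_{u\in U}$ elements of $\mathbb N^r$, i.e. monomials $m_u=\mathbf x^{\mathbf a_u}$ in $S=k[x_1,\dots,x_r]$, none dividing another, such that $S/(m_u:u\in U)$ is Cohen-Macaulay of codimension $\dim P+1=4$ and the cellular complex of $P$ labelled by the $m_u$ is a minimal free resolution of $S/(m_u:u\in U)$. Here each face $F$ (including the empty face) is labelled by the least common multiple $m_F$ of the labels of its vertices, and the cellular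 complex has a free generator $e_F$ in homological degree $\dim F+1$ for each face $F$, with differential $e_F\mapsto\sum_G\mathrm{sign}(G,F)\frac{m_F}{m_G}e_G$ over the codimension one faces $G$ of $F$, $\mathrm{sign}$ being an incidence function. A morphism $(\mathbb N^r,\mathbf a)\to(\mathbb N^s,\mathbf b)$ is a semigroup (monoid) homomorphism $\phi$ with $\phi(\mathbf a_u)=\mathbf b_u$ for all $u$. $\mathrm{CM}_*(P)$ is the full subcategory of objects with square free monomials such that the sets $V_p=\{u\in U: x_p\text{ divides }m_u\}$, one for each variable, are pairwise distinct. A family $\{V_1,\dots,V_r\}$ of subsets of $U$ corresponds to the labelling $m_u=\prod_{p:\,u\in V_p}x_p$. An object of $\mathrm{CM}(P)$ is maximal if for every morphism $\phi:(\mathbb N^s,\mathbf b)\to(\mathbb N^r,\mathbf a)$ in $\mathrm{CM}(P)$ to it, $\phi$ is surjective and there is a splitting, i.e. a morphism $\psi:(\mathbb N^r,\mathbf a)\to(\mathbb N^s,\mathbf b)$ with $\phi\circ\psi=\mathrm{id}$. A family is a maximal family in $\mathrm{CM}_*(P)$ if it corresponds to an object of $\mathrm{CM}_*(P)$ which is maximal. *)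

(* Defs.v *)
From HB Require Import structures.
From mathcomp Require Import all_boot all_order all_algebra.
From mathcomp Require Import mpoly.

Set Implicit Arguments.
Unset Strict Implicit.
Unset Printing Implicit Defensive.

Import GRing.Theory.
Local Open Scope ring_scope.

(* Notions for the quotient A / I are written in A: depth is that of A / I as an
   A-module, and primes of A / I are primes of A containing I. *)

Section CommutativeAlgebra.
Variable A : comNzRingType.
Implicit Types (I P Q : A -> Prop) (s : seq A) (n : nat).

Definition sub_ideal I P : Prop := forall x, I x -> P x.

Definition zero_ideal : A -> Prop := fun x => x = 0.

Definition is_ideal I : Prop :=
  [/\ I 0, forall x y, I x -> I y -> I (x + y) & forall a x, I x -> I (a * x)].

Definition prime_ideal P : Prop :=
  [/\ is_ideal P, ~ P 1 & forall x y, P (x * y) -> P x \/ P y].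

Definition maximal_ideal P : Prop :=
  [/\ is_ideal P, ~ P 1 &
      forall Q, is_ideal Q -> ~ Q 1 -> sub_ideal P Q -> sub_ideal Q P].

Definition span_ideal (J : finType) (f : J -> A) : A -> Prop :=
  fun x => exists c : J -> A, x = \sum_j c j * f j.

(* I + (s_0, ..., s_{n-1}), where n = size s *)
Definition adjoin_ideal I s : A -> Prop :=
  fun x => exists2 y, I y &
    exists c : 'I_(size s) -> A, x = y + \sum_j c j * s`_j.

Definition regular_sequence I s : Prop :=
  (forall i x, (i < size s)%N ->
     adjoin_ideal I (take i s) (s`_i * x) -> adjoin_ideal I (take i s) x)
  /\ ~ adjoin_ideal I s 1.

(* depth (P, A / I) = n *)
Definition has_depth I P n : Prop :=
  (exists s, [/\ size s = n, forall x, x \in s -> P x & regular_sequence I s])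
  /\ (forall s, (forall x, x \in s -> P x) -> regular_sequence I s ->
        (size s <= n)%N).

(* a chain I <= p_0 < p_1 < ... < p_n = P of primes *)
Definition prime_chain I P n : Prop :=
  exists p : nat -> A -> Prop,
    [/\ forall i, (i <= n)%N -> prime_ideal (p i),
        sub_ideal I (p 0%N),
        forall i, (i < n)%N ->
          sub_ideal (p i) (p i.+1) /\ ~ sub_ideal (p i.+1) (p i)
      & forall x, p n x <-> P x].

(* the height of the prime P / I of A / I is n *)
Definition has_height I P n : Prop :=
  prime_chain I P n /\ (forall m, prime_chain I P m -> (m <= n)%N).

(* the ring A / I (A Noetherian) is Cohen-Macaulay: depth and height agree at
   every maximal ideal *)
Definition cohen_macaulay I : Prop :=
  forall P, maximal_ideal P -> sub_ideal I P ->
    exists n, has_depth I P n /\ has_height I P n.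

(* codim A / I = n, i.e. n is the least height of a prime of A containing I *)
Definition has_codim I n : Prop :=
  (exists P, [/\ prime_ideal P, sub_ideal I P & has_height zero_ideal P n])
  /\ (forall P m, prime_ideal P -> sub_ideal I P -> has_height zero_ideal P m ->
        (n <= m)%N).

End CommutativeAlgebra.

(* The vertices 0, ..., 7 of P are themselves and the vertex c is 8; a face of P
   is identified with its vertex set. *)

Notation vertex := 'I_9.

Definition vc : nat := 8.

Definition vset (s : seq nat) : {set vertex} := [set u : vertex | (u : nat) \in s].

(* faces i is the set of faces of dimension i - 1 *)
Definition faces (i : nat) : {set {set vertex}} :=
  match i with
  | 0 => [set set0]
  | 1 => [set [set u] | u : vertex]
  | 2 => [set:: map vset
           [:: [:: 0; 1]; [:: 1; 2]; [:: 2; 3]; [:: 3; 4];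
               [:: 4; 5]; [:: 5; 6]; [:: 6; 7]; [:: 7; 0];
               [:: vc; 1]; [:: vc; 3]; [:: vc; 5]; [:: vc; 7];
               [:: 0; 2]; [:: 2; 4]; [:: 4; 6]; [:: 6; 0]]]
  | 3 => [set:: map vset
           [:: [:: vc; 1; 2; 3]; [:: vc; 3; 4; 5]; [:: vc; 5; 6; 7];
               [:: vc; 7; 0; 1]; [:: 0; 2; 4; 6];
               [:: 0; 1; 2]; [:: 2; 3; 4]; [:: 4; 5; 6]; [:: 6; 7; 0]]]
  | 4 => [set setT]
  | _ => set0
  end%N.

Definition cell (i : nat) : finType := {F : {set vertex} | F \in faces i}.

(* G is a codimension one face of F *)
Definition is_facet (G F : {set vertex}) : bool :=
  [exists i : 'I_4, [&& G \in faces i, F \in faces i.+1 & G \subset F]].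

Definition incidence_function (sgn : {set vertex} -> {set vertex} -> int) : Prop :=
  [/\ forall G F, is_facet G F -> sgn G F = 1 \/ sgn G F = -1,
      forall G F, ~~ is_facet G F -> sgn G F = 0,
      forall u, sgn set0 [set u] = 1
    & forall i H F, H \in faces i -> F \in faces i.+2 -> H \subset F ->
        \sum_(G | is_facet H G && is_facet G F) sgn H G * sgn G F = 0].

Definition labelling (r : nat) : Type := vertex -> 'X_{1..r}.

Definition face_label r (a : labelling r) (F : {set vertex}) : 'X_{1..r} :=
  \big[@mlcm r/0%MM]_(u in F) a u.

Definition label_ideal (k : fieldType) r (a : labelling r) : {mpoly k[r]} -> Prop :=
  span_ideal (fun u : vertex => 'X_[k, a u]).

(* a chain z has coordinate z F on the generator e_F *)
Definition cell_diff (k : fieldType) (sgn : {set vertex} -> {set vertex} -> int)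
    r (a : labelling r) i (z : {ffun cell i.+1 -> {mpoly k[r]}}) :
    {ffun cell i -> {mpoly k[r]}} :=
  [ffun G => \sum_(F : cell i.+1 | is_facet (val G) (val F))
     (sgn (val G) (val F))%:~R
       * 'X_[k, face_label a (val F) - face_label a (val G)] * z F].

(* The first clause says that e_(empty face) |-> 1 identifies the cokernel of
   the last differential with S / (m_u). *)
Definition free_resolution (k : fieldType) sgn r (a : labelling r) : Prop :=
  (forall z0 : {ffun cell 0 -> {mpoly k[r]}},
     (exists z, z0 = cell_diff sgn a z) <-> (forall G, label_ideal a (z0 G)))
  /\ (forall i (z : {ffun cell i.+1 -> {mpoly k[r]}}),
        cell_diff sgn a z = 0 <-> exists w, z = cell_diff sgn a w).

(* the differentials have image in (x_1, ..., x_r) times their target *)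
Definition minimal_differentials (k : fieldType) sgn r (a : labelling r) : Prop :=
  forall i (z : {ffun cell i.+1 -> {mpoly k[r]}}) G,
    span_ideal (fun p : 'I_r => 'X_p) (cell_diff sgn a z G).

Definition CM_object (k : fieldType) sgn r (a : labelling r) : Prop :=
  [/\ forall u v, u != v -> ~~ (a u <= a v)%MM,
      cohen_macaulay (@label_ideal k r a),
      has_codim (@label_ideal k r a) 4,
      free_resolution k sgn a
    & minimal_differentials k sgn a].

Definition CM_morphism r s (a : labelling r) (b : labelling s)
    (phi : 'X_{1..r} -> 'X_{1..s}) : Prop :=
  [/\ phi 0%MM = 0%MM,
      forall m n, phi (m + n)%MM = (phi m + phi n)%MM
    & forall u, phi (a u) = b u].

(* V_p, the set of vertices u such that x_p divides m_u *)
Definition var_support r (a : labelling r) (p : 'I_r) : {set vertex} :=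
  [set u | (U_(p) <= a u)%MM].

Definition CM_star_object (k : fieldType) sgn r (a : labelling r) : Prop :=
  [/\ CM_object k sgn a,
      forall u p, (a u p <= 1)%N
    & injective (var_support a)].

Definition maximal_object (k : fieldType) sgn r (a : labelling r) : Prop :=
  CM_object k sgn a /\
  forall s (b : labelling s) (phi : 'X_{1..s} -> 'X_{1..r}),
    CM_object k sgn b -> CM_morphism b a phi ->
    (forall m, exists n, phi n = m) /\
    (exists psi, CM_morphism a b psi /\ forall m, phi (psi m) = m).

Definition family_labelling r (V : r.-tuple {set vertex}) : labelling r :=
  fun u => [multinom (u \in tnth V p : nat) | p < r].

Definition maximal_family (k : fieldType) sgn r (V : r.-tuple {set vertex}) : Prop :=
  CM_star_object k sgn (family_labelling V) /\
  maximal_object k sgn (family_labelling V).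

(* Main.v *)
(* Cohen-Macaulayness: the label ideal I is vertex decomposable with all minimal
   primes generated by four variables.  Splitting along I : x and I + (x), a
   sequence is regular modulo I as soon as it is regular modulo each of these
   primes.  For a maximal ideal P the Nullstellensatz gives y_i in P, a
   polynomial in x_i alone and divisible by x_i, and then
   e_6(y), e_5(y), ..., e_1(y) is regular modulo each minimal prime.  Conversely,
   members of a regular sequence, or of the steps of a chain of primes, are
   algebraically independent modulo I, so a dimension count bounds depth and
   height by 6.

   Resolution: the strand of the cellular complex in degree n is the chain
   complex of the faces on the vertices u with a_u <= n, and each of these
   complexes that contains a vertex is collapsible.

   Maximality: let phi map an object b to the family.  The vertices u with
   b_u q > d form a set V, and for any sets V_p of the family the faces that miss
   V and these V_p form an acyclic complex (or the void one), being a strand of the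
   resolution of b.  Unless V is empty or a member of the family, some such complex
   is disconnected or the pentagon 1, 2, 4, 5, 8, or else V and two members of the
   family cover all vertices, which contradicts codimension 4.  So each column of b
   is a multiple of the indicator of some V_p, and this gives the splitting. *)

(* The field and the maximal ideal P are arbitrary and depth is measured in A itself, so neither
   generic linear forms nor localisation can supply a regular sequence. A sequence that suits all
   minimal primes at once should not depend on which variables generate them, hence symmetric
   functions: modulo each minimal prime four of the ten y_i vanish, and e_6(y) becomes the product
   of the other six.

   In the maximality argument codimension 4 enters twice, and the order matters. For a variable q of
   b whose image involves x_p, the set V lies in V_p, so a covering by V and two members is one by
   three members, against the codimension of the family. This shows that every V_p is the support of
   some variable of b. Only then can a covering that involves an arbitrary V be read as one by three
   variables of b, against the codimension of b.

   All finite combinatorics is evaluated on bit lists. Collapses and obstructions are found by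
   search functions about which nothing is proved; only their output is checked. *)
Require Import Defs.
From HB Require Import structures.
From mathcomp Require Import all_boot all_order all_algebra.
From mathcomp Require Import mpoly.
From mathcomp Require Import ring zify.
From Stdlib Require Import Classical ClassicalEpsilon.
From Stdlib Require Import FunctionalExtensionality PropExtensionality.

Set Implicit Arguments.
Unset Strict Implicit.
Unset Printing Implicit Defensive.

Import GRing.Theory.
Local Open Scope ring_scope.

(** * Weakly regular sequences *)

Section WeaklyRegular.
Variable A : comNzRingType.
Implicit Types (I J K : A -> Prop) (s : seq A).

Lemma idealN J x : is_ideal J -> J x -> J (- x).
Proof. by case=> _ _ JM Jx; rewrite -mulN1r; apply: JM. Qed.

Lemma idealB J x y : is_ideal J -> J x -> J y -> J (x - y).
Proof. by move=> iJ Jx Jy; case: (iJ) => _ JD _; apply: JD => //; apply: idealN. Qed.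

Lemma idealMr J x y : is_ideal J -> J x -> J (x * y).
Proof. by case=> _ _ JM Jx; rewrite mulrC; apply: JM. Qed.

Lemma ideal_sum J (T : Type) (r : seq T) (P : pred T) (F : T -> A) :
  is_ideal J -> (forall i, P i -> J (F i)) -> J (\sum_(i <- r | P i) F i).
Proof. by case=> J0 JD _ JF; apply: (big_ind J). Qed.

Lemma ideal_addl J x y : is_ideal J -> J y -> J (x + y) -> J x.
Proof. by move=> iJ Jy Jxy; rewrite -[x](addrK y); apply: idealB. Qed.

Lemma ideal_subl J x y : is_ideal J -> J y -> J (x - y) -> J x.
Proof. by move=> iJ Jy Jxy; rewrite -[x](subrK y); case: (iJ) => _ JD _; apply: JD. Qed.

Definition add_principal J x : A -> Prop := fun f => exists g, J (f - g * x).

Definition colon J x : A -> Prop := fun f => J (x * f).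

Definition nzd_mod J x : Prop := forall f, J (x * f) -> J f.

(** Regularity without the condition that the quotient is nonzero. A colon ideal met while splitting
    may be the unit ideal, so properness is recovered only at the end, from a prime that contains
    the sequence. *)
Fixpoint weakly_regular J s : Prop :=
  if s is x :: s' then nzd_mod J x /\ weakly_regular (add_principal J x) s'
  else True.

Lemma add_principal_ideal J x : is_ideal J -> is_ideal (add_principal J x).
Proof.
move=> iJ; case: (iJ) => J0 JD JM; split.
- by exists 0; rewrite mul0r subr0.
- move=> f g [a Ja] [b Jb]; exists (a + b).
  by have -> : f + g - (a + b) * x = (f - a * x) + (g - b * x) by [ring]; apply: JD.
- move=> a f [b Jb]; exists (a * b).
  by have -> : a * f - a * b * x = a * (f - b * x) by [ring]; apply: JM.
Qed.

Lemma add_principal_sub J x f : J f -> add_principal J x f.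
Proof. by move=> Jf; exists 0; rewrite mul0r subr0. Qed.

Lemma add_principal_gen J x : is_ideal J -> add_principal J x x.
Proof. by case=> J0 _ _; exists 1; rewrite mul1r subrr. Qed.

Lemma eq_nzd_mod J K x :
  (forall f, J f <-> K f) -> nzd_mod J x -> nzd_mod K x.
Proof. by move=> eJK nx f /eJK /nx /eJK. Qed.

Lemma eq_add_principal J K x f :
  (forall f, J f <-> K f) -> add_principal J x f <-> add_principal K x f.
Proof. by move=> eJK; split=> -[g]; exists g; apply/eJK. Qed.

Lemma eq_weakly_regular J K s :
  (forall f, J f <-> K f) -> weakly_regular J s -> weakly_regular K s.
Proof.
elim: s J K => //= x s IH J K eJK [nx ws]; split; first exact: eq_nzd_mod nx.
by apply: IH ws => f; apply: eq_add_principal.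
Qed.

Lemma weakly_regular_top J s : (forall f, J f) -> weakly_regular J s.
Proof.
elim: s J => //= x s IH J Jtop; split; first by move=> f _; apply: Jtop.
by apply: IH => f; apply: add_principal_sub.
Qed.

Lemma add_principalC J x y f :
  add_principal (add_principal J x) y f -> add_principal (add_principal J y) x f.
Proof.
move=> [g [h Jf]]; exists h, g.
by have -> : f - h * x - g * y = f - g * y - h * x by [ring].
Qed.

(* The snake lemma for 0 -> A/(J : x) -> A/J -> A/(J + x) -> 0. *)
Lemma weakly_regular_split J x s : is_ideal J ->
  weakly_regular (colon J x) s -> weakly_regular (add_principal J x) s ->
  weakly_regular J s.
Proof.
elim: s J => //= y s IH J iJ [ny1 ws1] [ny2 ws2]; split.
  move=> f Jyf; have [g Jg] : add_principal J x f.
    by apply: ny2; apply: add_principal_sub.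
  have Jxg : J (x * g).
    apply: ny1; rewrite /colon.
    have -> : x * (y * g) = y * f - y * (f - g * x) by ring.
    by apply: idealB => //; case: (iJ) => _ _; apply.
  by apply: (ideal_subl iJ Jxg); rewrite [x * g]mulrC.
apply: IH; first exact: add_principal_ideal.
  (* Since y is a nonzerodivisor modulo J + (x), the ideals (J + (y)) : x and (J : x) + (y)
     agree. *)
  apply: eq_weakly_regular ws1 => f; split=> -[g].
    rewrite /colon => Jg; exists (x * g).
    by have -> : x * f - x * g * y = x * (f - g * y) by ring.
  move=> Jg; have [h Jh] : add_principal J x g.
    apply: ny2; exists f.
    have -> : y * g - f * x = - (x * f - g * y) by ring.
    exact: idealN.
  exists h; rewrite /colon.
  have -> : x * (f - h * y) = x * f - g * y + y * (g - h * x) by ring.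
  by case: (iJ) => _ JD JM; apply: JD => //; apply: JM.
by apply: eq_weakly_regular ws2 => f; split; apply: add_principalC.
Qed.

Lemma adjoin_ideal_nil J f : adjoin_ideal J [::] f <-> J f.
Proof.
split=> [[y Jy [c ->]]|Jf]; first by rewrite big_ord0 addr0.
by exists f => //; exists (fun=> 0); rewrite big_ord0 addr0.
Qed.

Lemma adjoin_ideal_cons J x s f :
  adjoin_ideal J (x :: s) f <-> adjoin_ideal (add_principal J x) s f.
Proof.
split=> [[y Jy [c ->]]|[y [g Jy] [c ->]]].
  exists (y + c ord0 * x); first by exists (c ord0); rewrite addrK.
  exists (fun j => c (lift ord0 j)).
  rewrite /= (big_ord_recl (size s)) /= addrA; congr (_ + _).
exists (y - g * x) => //.
exists (fun j : 'I_(size s).+1 => if unlift ord0 j is Some j' then c j' else g).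
rewrite /= (big_ord_recl (size s)) /= unlift_none.
under [in RHS]eq_bigr => j _ do rewrite liftK.
by rewrite addrA subrK.
Qed.

Lemma adjoin_idealP J s f P : is_ideal P -> sub_ideal J P ->
  (forall x, x \in s -> P x) -> adjoin_ideal J s f -> P f.
Proof.
move=> iP JP sP [y /JP Py [c ->]]; case: (iP) => _ PD PM.
apply: PD => //; apply: ideal_sum => // j _; apply: PM; apply: sP.
exact: mem_nth.
Qed.

Lemma weakly_regular_take J s i f : weakly_regular J s -> (i < size s)%N ->
  adjoin_ideal J (take i s) (s`_i * f) -> adjoin_ideal J (take i s) f.
Proof.
elim: s J i => // x s IH J [|i] [nx ws] /= lt_is.
  by move=> /adjoin_ideal_nil /nx Jf; apply/adjoin_ideal_nil.
by move=> /adjoin_ideal_cons aj; apply/adjoin_ideal_cons; apply: IH aj.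
Qed.

Lemma regular_sequence_in_prime J s P : prime_ideal P -> sub_ideal J P ->
  (forall x, x \in s -> P x) -> weakly_regular J s -> regular_sequence J s.
Proof.
move=> [iP P1 _] JP sP ws; split=> [i x lt_is|/(adjoin_idealP iP JP sP) //].
exact: weakly_regular_take.
Qed.

End WeaklyRegular.

(** * Algebraic independence and dimension *)

Fixpoint exponents (N m : nat) : seq (seq nat) :=
  if m is m'.+1 then [seq a :: e | a <- iota 0 N, e <- exponents N m']
  else [:: [::]].

Lemma size_exponents N m : size (exponents N m) = (N ^ m)%N.
Proof. by elim: m => //= m IH; rewrite size_allpairs size_iota IH expnS. Qed.

Lemma uniq_exponents N m : uniq (exponents N m).
Proof.
elim: m => //= m IH; apply: allpairs_uniq => //; first exact: iota_uniq.
by move=> [a e] [b f] _ _ [-> ->].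
Qed.

Section Dimension.
Variables (k : fieldType) (n : nat).
Local Notation A := {mpoly k[n]}.
Implicit Types (y : nat -> A) (c : seq nat -> k) (J : nat -> A -> Prop).

Fixpoint power_product y (e : seq nat) : A :=
  if e is a :: e' then y 0%N ^+ a * power_product (fun i => y i.+1) e' else 1.

Definition combination N m y c : A :=
  \sum_(e <- exponents N m) c e *: power_product y e.

Lemma combinationS N m y c :
  combination N m.+1 y c =
  \sum_(a < N) y 0%N ^+ a *
    combination N m (fun i => y i.+1) (fun e => c ((a : nat) :: e)).
Proof.
rewrite /combination /= big_allpairs_dep /=.
rewrite -(big_mkord xpredT (fun a => y 0%N ^+ a *
  \sum_(e <- exponents N m) c (a :: e) *: power_product (fun i => y i.+1) e)).
rewrite /index_iota subn0; apply: eq_bigr => a _; rewrite mulr_sumr.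
by apply: eq_bigr => e _; rewrite scalerAr.
Qed.

Lemma nzd_modX (J : A -> Prop) x a f :
  nzd_mod J x -> J (x ^+ a * f) -> J f.
Proof.
by move=> nx; elim: a => [|a IH]; rewrite ?expr0 ?mul1r // exprS -mulrA => /nx.
Qed.

Lemma ideal_constant (J : A -> Prop) (c : k) : is_ideal J -> ~ J 1 -> J c%:MP -> c = 0.
Proof.
move=> [_ _ JM] J1 Jc; apply/eqP/negP => /negP c0; apply: J1.
by rewrite -(mpolyC1 n k) -(mulVf c0) mpolyCM; apply: JM.
Qed.

(* Factoring out the lowest power of y 0 that occurs reduces to the tail. *)
Lemma flag_independent N m J y c :
  (forall i, (i <= m)%N -> is_ideal (J i)) ->
  (forall i, (i < m)%N -> sub_ideal (J i) (J i.+1)) ->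
  (forall i, (i < m)%N -> J i.+1 (y i)) ->
  (forall i, (i < m)%N -> nzd_mod (J i) (y i)) ->
  ~ J m 1 -> J 0%N (combination N m y c) ->
  forall e, e \in exponents N m -> c e = 0.
Proof.
elim: m J y c => [|m IH] J y c iJ sJ yJ nJ J1 Jc e.
  rewrite inE => /eqP ->.
  apply: (ideal_constant (iJ 0%N (leqnn _)) J1); move: Jc.
  by rewrite /combination big_seq1 /= -alg_mpolyC.
case/allpairsP => -[a f] /= []; rewrite mem_iota /= add0n => ltaN fN -> {e}.
have [b] := ubnP a; elim: b a f ltaN fN => // b IHb a f ltaN fN ltab.
pose z := combination N m (fun i => y i.+1).
have zero a' : (a' < a)%N -> z (fun e => c (a' :: e)) = 0.
  move=> lta; rewrite /z /combination big_seq big1 // => g gN.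
  by rewrite /= (IHb a' g) ?scale0r //; lia.
pose R := \sum_(i < N | (a < i)%N) y 0%N ^+ (i - a.+1) * z (fun e => c (val i :: e)).
have {}Jc : J 0%N (y 0%N ^+ a * (z (fun e => c (a :: e)) + R * y 0%N)).
  move: Jc; rewrite combinationS (bigD1 (Ordinal ltaN)) //= -/z.
  congr (J _ _); rewrite mulrDr; congr (_ + _).
  rewrite (bigID (fun i : 'I_N => (a < i)%N)) /= [X in _ + X]big1 ?addr0; last first.
    move=> i /andP[nia ltai]; rewrite -/(z _) zero ?mulr0 //.
    have : (i : nat) != a by apply: contra nia => /eqP E; apply/eqP/val_inj.
    by move: ltai; lia.
  rewrite mulr_suml mulr_sumr; apply: eq_big => [i|i /andP[_ ltai]].
    by case: eqVneq => [->|_] //=; rewrite ltnn.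
  have {1}-> : (i : nat) = (a + (i - a.+1).+1)%N by lia.
  by rewrite -/(z _) exprD exprS; ring.
have {}Jc := nzd_modX (nJ 0%N isT) Jc.
apply: (IH (fun i => J i.+1) (fun i => y i.+1) (fun e => c (a :: e))) => //.
- by move=> i le_im; apply: iJ.
- by move=> i lt_im; apply: sJ.
- by move=> i lt_im; apply: yJ.
- by move=> i lt_im; apply: nJ.
apply: (ideal_addl (iJ 1%N _) _ (sJ 0%N isT _ Jc)) => //.
by case: (iJ 1%N isT) => _ _; apply; apply: yJ.
Qed.

Lemma msizeM_leS (p q : A) a b :
  (msize p <= a.+1)%N -> (msize q <= b.+1)%N -> (msize (p * q) <= (a + b).+1)%N.
Proof.
have [->|p0] := eqVneq p 0; first by rewrite mul0r msize0.
have [->|q0] := eqVneq q 0; first by rewrite mulr0 msize0.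
by rewrite msizeM //; move: (msize p) (msize q) => u v; lia.
Qed.

Lemma msize_power_product D N m y e :
  (forall i, (i < m)%N -> (msize (y i) <= D.+1)%N) -> e \in exponents N m ->
  (msize (power_product y e) <= (m * (N * D)).+1)%N.
Proof.
elim: m y e => [|m IH] y e yD; first by rewrite inE => /eqP -> /=; rewrite msize1.
case/allpairsP => -[a f] /= []; rewrite mem_iota /= add0n => ltaN fN ->.
rewrite mulSn; apply: msizeM_leS; last by apply: IH => // i ?; apply: yD.
apply: (@leq_trans (a * D).+1); last by rewrite ltnS leq_mul // ltnW.
elim: a {ltaN} => [|a IHa]; first by rewrite expr0 msize1.
by rewrite exprS mulSn; apply: msizeM_leS => //; apply: yD.
Qed.

Lemma card_bigcup_seq (T I : finType) (s : seq I) (F : I -> {set T}) b :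
  (forall i, i \in s -> (#|F i| <= b)%N) ->
  (#|\bigcup_(i <- s) F i| <= size s * b)%N.
Proof.
elim: s => [|i s IH] Fb; first by rewrite big_nil cards0.
rewrite big_cons mulSn; apply: leq_trans (leq_card_setU _ _) _.
apply: leq_add; first by apply: Fb; rewrite mem_head.
by apply: IH => j js; apply: Fb; rewrite inE js orbT.
Qed.

(* The monomials outside I are supported on the sets in Fs, so the N^(d+1)
   products of powers less than N live, modulo I, in a space of dimension
   O(N^d). *)
Lemma exists_relation (I : A -> Prop) (Fs : seq {set 'I_n}) d y :
  is_ideal I -> (forall F, F \in Fs -> (#|F| <= d)%N) ->
  (forall m : 'X_{1..n}, I 'X_[m] \/
     exists2 F, F \in Fs & forall i, i \notin F -> m i = 0%N) ->
  exists N c, I (combination N d.+1 y c) /\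
    exists2 e, e \in exponents N d.+1 & c e != 0.
Proof.
move=> iI cardF suppF; pose D := (\max_(i < d.+1) msize (y i))%N.
have yD i : (i < d.+1)%N -> (msize (y i) <= D.+1)%N.
  by move=> lti; rewrite leqW //; apply: (leq_bigmax (Ordinal lti)).
(* Power products have degree at most B, and B + 1 <= N * C. So at most size Fs * (N * C)^d
   monomials matter, which is less than N^(d+1) because N exceeds size Fs * C^d. *)
pose C := (d.+1 * D).+1; pose N := (size Fs * C ^ d).+1.
pose B := (d.+1 * (N * D))%N.
pose S := \bigcup_(F <- Fs)
  [set f : {ffun 'I_n -> 'I_B.+1} | f \in pffun_on ord0 (mem F) predT].
have ltSN : (#|S| < N ^ d.+1)%N.
  apply: leq_ltn_trans (_ : (size Fs * B.+1 ^ d < _)%N).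
    apply: card_bigcup_seq => F /cardF leF; rewrite cardsE card_pffun_on card_ord.
    exact: leq_pexp2l.
  apply: (@leq_ltn_trans (size Fs * (N * C) ^ d)).
    have leBC : (B < N * C)%N by rewrite /B /C mulnS mulnCA; lia.
    rewrite leq_mul2l; apply/orP; right.
    by case: (d) => // e; rewrite leq_exp2r.
  by rewrite expnMn mulnCA [(N ^ d.+1)%N]expnS mulnC ltn_pmul2r // expn_gt0.
pose mon (f : {ffun 'I_n -> 'I_B.+1}) := [multinom (f i : nat) | i < n].
pose es := exponents N d.+1.
have sz_es : size es = (N ^ d.+1)%N by rewrite size_exponents.
pose M : 'M[k]_(size es, #|S|) :=
  \matrix_(i, j) (power_product y (nth [::] es i))@_(mon (enum_val j)).
have : kermx M != 0.
  rewrite -mxrank_eq0 mxrank_ker subn_eq0 -ltnNge.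
  by apply: leq_ltn_trans (rank_leq_col _) _; rewrite sz_es.
case/rowV0Pn => u /sub_kermxP uM u0.
pose c e := if insub (index e es) is Some i then u 0 i else 0.
have cE (i : 'I_(size es)) : c (nth [::] es i) = u 0 i.
  by rewrite /c index_uniq ?uniq_exponents // valK.
exists N, c; split; last first.
  have [i ui] : exists i, u 0 i != 0.
    apply/existsP; apply: contraR u0; rewrite negb_exists => /forallP z.
    by apply/eqP/rowP => i; rewrite mxE; apply/eqP; move: (z i); rewrite negbK.
  by exists (nth [::] es i); rewrite ?cE // mem_nth.
set p := combination _ _ _ _.
have szp : (msize p <= B.+1)%N.
  apply: leq_trans (msize_sum _ _ _) _; apply/bigmax_leqP_seq => e es_e _.
  by apply: leq_trans (msizeZ_le _ _) _; apply: msize_power_product.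
rewrite (mpolyE p) big_seq; apply: ideal_sum => // m pm.
case: (suppF m) => [Im|[F FFs Fm]].
  by rewrite -mul_mpolyC; case: iI => _ _; apply.
move: (pm); rewrite mcoeff_msupp => /eqP; case.
have leB i : (m i < B.+1)%N.
  apply: leq_trans szp; apply: leq_ltn_trans (msize_mdeg_lt pm).
  by rewrite mdegE (bigD1 i) //= leq_addr.
pose f := [ffun i => Ordinal (leB i)].
have Sf : f \in S.
  rewrite /S (big_rem F) //= inE; apply/orP; left; rewrite inE.
  apply/pffun_onP; split; last by move=> z _.
  apply/supportP => i iF; rewrite ffunE; apply/val_inj => /=.
  exact: Fm.
have -> : m = mon f by apply/mnmP => i; rewrite mnmE ffunE.
move/matrixP/(_ 0 (enum_rank_in Sf f)): uM; rewrite !mxE => <-.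
rewrite /p /combination raddf_sum (big_nth [::]) big_mkord /=.
by apply: eq_bigr => i _; rewrite mcoeffZ cE mxE enum_rankK_in.
Qed.

(** In a longer flag the first d + 1 elements would be independent modulo I, against
    [exists_relation]. Chains of primes and regular sequences both give flags of this kind, so one
    bound serves height and depth. *)
Lemma flag_length (I : A -> Prop) (Fs : seq {set 'I_n}) d m J y :
  is_ideal I -> (forall F, F \in Fs -> (#|F| <= d)%N) ->
  (forall m : 'X_{1..n}, I 'X_[m] \/
     exists2 F, F \in Fs & forall i, i \notin F -> m i = 0%N) ->
  sub_ideal I (J 0%N) ->
  (forall i, (i <= m)%N -> is_ideal (J i)) ->
  (forall i, (i < m)%N -> sub_ideal (J i) (J i.+1)) ->
  (forall i, (i < m)%N -> J i.+1 (y i)) ->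
  (forall i, (i < m)%N -> nzd_mod (J i) (y i)) ->
  ~ J m 1 -> (m <= d)%N.
Proof.
move=> iI cF sF IJ iJ sJ yJ nJ J1; case: leqP => // ltdm; exfalso.
have [N [c [Ic [e eN]]]] := exists_relation y iI cF sF.
move/eqP; apply; apply: (@flag_independent N d.+1 J y c) => //.
- by move=> i lei; apply: iJ; apply: leq_trans ltdm.
- by move=> i lei; apply: sJ; apply: leq_trans ltdm.
- by move=> i lei; apply: yJ; apply: leq_trans ltdm.
- by move=> i lei; apply: nJ; apply: leq_trans ltdm.
- move=> Jd1; apply: J1.
  have Jd i : (d.+1 + i <= m)%N -> J (d.+1 + i)%N 1.
    elim: i => [|i IH]; first by rewrite addn0.
    by rewrite addnS => lti; apply: sJ => //; apply: IH; apply: ltnW.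
  by rewrite -(subnKC ltdm); apply: Jd; rewrite subnKC.
- exact: IJ.
Qed.

End Dimension.

(** * Expansion with respect to a variable *)

Lemma least_counterexample (Q : nat -> Prop) :
  ~ (forall d, Q d) -> exists2 d, ~ Q d & forall e, (e < d)%N -> Q e.
Proof.
move=> nQ; apply: NNPP => no; apply: nQ => d.
have [b] := ubnP d; elim: b d => // b IH d; rewrite ltnS => led.
apply: NNPP => nd; apply: no; exists d => // e lted.
by apply: IH; apply: leq_trans led.
Qed.

Section Polynomials.
Variables (k : fieldType) (n : nat).
Local Notation A := {mpoly k[n]}.
Implicit Types (f g : A) (i j : 'I_n) (S T : {set 'I_n}) (P Q K : A -> Prop).

(** Reduces the identities between the substitutions below to constants and variables. *)
Lemma mpoly_rmorph_ext (R : comNzRingType) (u v : {rmorphism A -> R}) :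
  (forall c, u c%:MP = v c%:MP) -> (forall i, u 'X_i = v 'X_i) -> u =1 v.
Proof.
move=> eC eX f; rewrite (mpolyE f) !rmorph_sum; apply: eq_bigr => m _.
rewrite -mul_mpolyC !rmorphM eC mpolyXE_id !rmorph_prod; congr (_ * _).
by apply: eq_bigr => i _; rewrite !rmorphXn eX.
Qed.

(* f as a polynomial in x_i with coefficients free of x_i *)
Definition expand i : A -> {poly A} :=
  mmap (polyC \o @mpolyC n k) (fun j => if j == i then 'X else ('X_j)%:P).

HB.instance Definition _ i := GRing.RMorphism.copy (expand i)
  (mmap (polyC \o @mpolyC n k) (fun j => if j == i then 'X else ('X_j)%:P)).

(** The equation [retract S f = f] is how it is expressed, here and below, that f involves only the
    variables of S. *)
Definition retract S : A -> A :=
  mmap (@mpolyC n k) (fun j => if j \in S then 'X_j else 0).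

HB.instance Definition _ S := GRing.RMorphism.copy (retract S)
  (mmap (@mpolyC n k) (fun j => if j \in S then 'X_j else 0)).

Lemma expandC i c : expand i c%:MP = c%:MP%:P.
Proof. exact: mmapC. Qed.

Lemma expandX i j : expand i 'X_j = if j == i then 'X else ('X_j)%:P.
Proof. by rewrite /expand mmapX mmap1U. Qed.

Lemma retractC S c : retract S c%:MP = c%:MP.
Proof. exact: mmapC. Qed.

Lemma retractX S j : retract S 'X_j = if j \in S then 'X_j else 0.
Proof. by rewrite /retract mmapX mmap1U. Qed.

Lemma retractXm S (m : 'X_{1..n}) :
  retract S 'X_[m] = if [exists j in ~: S, m j != 0%N] then 0 else 'X_[m].
Proof.
rewrite /retract mmapX /mmap1; case: ifP => [/exists_inP[j]|/negbT].
  rewrite inE => jS mj; rewrite (bigD1 j) //= (negbTE jS) expr0n.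
  by rewrite (negbTE mj) mul0r.
rewrite negb_exists_in => /forall_inP mS; rewrite mpolyXE_id.
apply: eq_bigr => j _; case: ifP => // jS; have := mS j.
by rewrite inE jS negbK => /(_ isT) /eqP ->.
Qed.

(* Otherwise unification unfolds the sums that define the substitutions. *)
Opaque expand retract.

Lemma expandM i f g : expand i (f * g) = expand i f * expand i g.
Proof. exact: rmorphM. Qed.

Lemma retractD S f g : retract S (f + g) = retract S f + retract S g.
Proof. exact: rmorphD. Qed.

Lemma retractM S f g : retract S (f * g) = retract S f * retract S g.
Proof. exact: rmorphM. Qed.

Lemma expandK i f : (expand i f).['X_i] = f.
Proof.
apply: (mpoly_rmorph_ext (u := horner_eval 'X_i \o expand i) (v := idfun)) f => [c|j] /=.
  by rewrite /horner_eval expandC hornerC.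
by rewrite /horner_eval expandX; case: eqP => [->|_]; rewrite ?hornerX ?hornerC.
Qed.

Lemma retract_setI S T f : retract S (retract T f) = retract (S :&: T) f.
Proof.
apply: (mpoly_rmorph_ext (u := retract S \o retract T) (v := retract (S :&: T))) f => [c|j] /=.
  by rewrite !retractC.
by rewrite !retractX inE; case: (j \in T); rewrite ?andbF ?rmorph0 ?retractX ?andbT.
Qed.

Lemma retract_id S f : retract S (retract S f) = retract S f.
Proof. by rewrite retract_setI setIid. Qed.

Lemma retract0 f : retract set0 f = (f@_0)%:MP.
Proof.
apply: (mpoly_rmorph_ext (u := retract set0) (v := @mpolyC n k \o mcoeff 0%MM)) f => [c|j] /=.
  by rewrite retractC mcoeffC eqxx mulr1.
by rewrite retractX inE mcoeffX mnm1_eq0 mpolyC0.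
Qed.

Lemma expand_retract S i f :
  expand i (retract (i |: S) f) = map_poly (retract S) (expand i f).
Proof.
apply: (mpoly_rmorph_ext (u := expand i \o retract (i |: S))
  (v := map_poly (retract S) \o expand i)) f => [c|j] /=.
  by rewrite !(retractC, expandC) map_polyC /= retractC.
rewrite retractX !inE expandX; case: eqP => [->|ne] /=.
  by rewrite expandX eqxx map_polyX.
rewrite map_polyC /= retractX; case: ifP => _; rewrite ?rmorph0 //.
by rewrite expandX; case: eqP.
Qed.

Lemma expand_free S i f : i \notin S -> retract S f = f -> expand i f = f%:P.
Proof.
move=> iS fS; rewrite -fS; move: f {fS}.
apply: (mpoly_rmorph_ext (u := expand i \o retract S) (v := polyC \o retract S)) => [c|j] /=.
  by rewrite retractC expandC.
rewrite retractX; case: ifP => jS; last by rewrite rmorph0 polyC0.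
by rewrite expandX; case: eqP jS iS => // -> ->.
Qed.

Definition xcoef i d f : A := (expand i f)`_d.

Lemma xcoefM i d f g :
  xcoef i d (f * g) = \sum_(e < d.+1) xcoef i e f * xcoef i (d - e)%N g.
Proof. by rewrite /xcoef expandM coefM. Qed.

Lemma xcoef_retract S i d f :
  xcoef i d (retract (i |: S) f) = retract S (xcoef i d f).
Proof. by rewrite /xcoef expand_retract coef_map. Qed.

Lemma xcoef_free S i d f : i \notin S -> retract S f = f ->
  xcoef i d f = if d == 0%N then f else 0.
Proof. by move=> iS fS; rewrite /xcoef (expand_free iS fS) coefC. Qed.

Lemma xcoefD i d f g : xcoef i d (f + g) = xcoef i d f + xcoef i d g.
Proof. by rewrite /xcoef rmorphD coefD. Qed.

Lemma xcoef0 i d : xcoef i d 0 = 0.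
Proof. by rewrite /xcoef rmorph0 coef0. Qed.

Lemma xcoef1 i : xcoef i 0 1 = 1.
Proof. by rewrite /xcoef rmorph1 coef1. Qed.

Lemma xcoefE i f : f = \sum_(d < size (expand i f)) xcoef i d f * 'X_i ^+ d.
Proof. by rewrite -{1}(expandK i f) horner_coef. Qed.

Lemma xcoef_lead i f : f != 0 ->
  exists d, xcoef i d f != 0 /\ f = \sum_(a < d.+1) xcoef i a f * 'X_i ^+ a.
Proof.
move=> f0; have s0 : (0 < size (expand i f))%N.
  rewrite lt0n; apply: contraNneq f0 => /eqP; rewrite size_poly_eq0 => /eqP E.
  by rewrite -(expandK i f) E horner0.
exists (size (expand i f)).-1; rewrite prednK //; split; last exact: xcoefE.
by rewrite /xcoef -lead_coefE lead_coef_eq0 -size_poly_gt0.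
Qed.

Opaque xcoef.

(** For an ideal P this is the extension to A of the contraction of P to the polynomials free of
    x_i. *)
Definition coef_ideal i P : A -> Prop := fun f => forall d, P (xcoef i d f).

Lemma coef_idealW i P f : is_ideal P -> coef_ideal i P f -> P f.
Proof.
move=> iP cf; rewrite (xcoefE i f).
by apply: ideal_sum => // d _; apply: idealMr => //; apply: cf.
Qed.

Lemma coef_ideal_free S i P f :
  is_ideal P -> i \notin S -> retract S f = f -> P f -> coef_ideal i P f.
Proof.
by move=> [P0 _ _] iS fS Pf d; rewrite (xcoef_free d iS fS); case: ifP.
Qed.

Lemma coef_ideal_ideal i P : is_ideal P -> is_ideal (coef_ideal i P).
Proof.
move=> iP; case: (iP) => P0 PD PM; split=> [d|f g cf cg d|a f cf d].
- by rewrite xcoef0.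
- by rewrite xcoefD; apply: PD; [apply: cf|apply: cg].
- by rewrite xcoefM; apply: ideal_sum => // e _; apply: PM; apply: cf.
Qed.

(** In the Cauchy product of degree a + b every other term has a factor of index below a or below b,
    and that factor lies in K. *)
Lemma xcoefM_lowest K i f g a b : is_ideal K ->
  (forall c, (c < a)%N -> K (xcoef i c f)) ->
  (forall c, (c < b)%N -> K (xcoef i c g)) ->
  K (xcoef i (a + b) (f * g)) -> K (xcoef i a f * xcoef i b g).
Proof.
move=> iK fK gK; have lta : (a < (a + b).+1)%N by rewrite ltnS leq_addr.
rewrite xcoefM (bigD1 (Ordinal lta)) //= addKn => Kfg.
apply: (ideal_addl iK _ Kfg).
apply: ideal_sum => // c /eqP nca.
have [ltca|leac] := ltnP c a; first by apply: idealMr => //; apply: fK.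
case: (iK) => _ _; apply; apply: gK.
have : (c : nat) <> a by move=> E; apply: nca; apply/val_inj.
by have := ltn_ord c; move: leac; lia.
Qed.

(** As for Gauss's lemma: multiply the lowest coefficients of f and g that lie outside P. *)
Lemma coef_ideal_prime i P : prime_ideal P -> prime_ideal (coef_ideal i P).
Proof.
move=> [iP P1 Pprime]; split; first exact: coef_ideal_ideal.
  by move/(_ 0%N); rewrite xcoef1.
move=> f g cfg; apply: NNPP => /not_or_and [nf ng].
have [a na fa] := least_counterexample nf.
have [b nb gb] := least_counterexample ng.
by case: (Pprime _ _ (xcoefM_lowest iP fa gb (cfg _))).
Qed.

Lemma nonzero_univariate_coef i f : retract [set i] f = f -> f != 0 ->
  exists c d, [/\ c != 0, xcoef i d f = c%:MP
                & forall e, (e < d)%N -> xcoef i e f = 0].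
Proof.
move=> fi f0.
have fE d : xcoef i d f = ((xcoef i d f)@_0)%:MP.
  by rewrite -retract0 -xcoef_retract setU0 fi.
have : ~ (forall d, xcoef i d f = 0).
  by move=> z; move/eqP: f0; apply; rewrite (xcoefE i f) big1 // => d _; rewrite z mul0r.
case/least_counterexample => d nd lt; exists (xcoef i d f)@_0, d; split => //.
by apply/eqP => z; apply: nd; rewrite fE z mpolyC0.
Qed.

(* Compare the lowest coefficients of h and f with respect to x_i. *)
Lemma nzd_mod_univariate K i h : is_ideal K ->
  (forall f, K f -> coef_ideal i K f) -> retract [set i] h = h -> h != 0 ->
  nzd_mod K h.
Proof.
move=> iK cK hi h0 f Khf; apply: (coef_idealW (i := i)) => //.
apply: NNPP => /least_counterexample [b nb fb].
have [c [a [c0 ha hlt]]] := nonzero_univariate_coef hi h0.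
have Kh e : (e < a)%N -> K (xcoef i e h) by move=> /hlt ->; case: iK.
apply: nb; have := xcoefM_lowest iK Kh fb (cK _ Khf _).
rewrite ha; set x := xcoef i b f => Kc.
have -> : x = c^-1%:MP * (c%:MP * x) by rewrite mulrA -mpolyCM mulVf // mpolyC1 mul1r.
by case: iK => _ _ KM; apply: KM.
Qed.

Lemma not_coef_ideal_univariate P i h : prime_ideal P ->
  retract [set i] h = h -> h != 0 -> ~ coef_ideal i P h.
Proof.
move=> [iP P1 _] hi h0 ch.
have [c [a [c0 ha _]]] := nonzero_univariate_coef hi h0.
by have := ch a; rewrite ha => /(ideal_constant iP P1) /eqP; rewrite (negbTE c0).
Qed.

(** An ideal as soon as D is stable under adding exponents. Colon by a variable and sum with a
    variable then become operations on the predicate D. *)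
Definition monomial_ideal (D : 'X_{1..n} -> bool) : A -> Prop :=
  fun f => forall m, f@_m != 0 -> D m.

Definition vars_prime T : A -> Prop :=
  monomial_ideal (fun m => [exists j in T, m j != 0%N]).

Lemma mcoeff_retract S f m :
  (retract S f)@_m = if [exists j in ~: S, m j != 0%N] then 0 else f@_m.
Proof.
rewrite {1}(mpolyE f) rmorph_sum raddf_sum /=.
rewrite [in RHS](mpolyE f) raddf_sum /=.
under eq_bigr => e _ do rewrite -mul_mpolyC rmorphM /= retractC retractXm mcoeffCM.
case: ifP => Sm; [apply: big1 => e _|apply: eq_bigr => e _].
  case: ifP => Se; rewrite ?mcoeff0 ?mulr0 // mcoeffX.
  by case: eqP Se Sm => [->->|]; rewrite ?mulr0.
rewrite mcoeffZ; case: ifP => Se; rewrite ?mcoeff0 // mcoeffX.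
by case: eqP Se Sm => [->->|]; rewrite ?mulr0.
Qed.

(** Being the kernel of a ring map into a domain is what makes this ideal prime. *)
Lemma vars_primeE T f : vars_prime T f <-> retract (~: T) f = 0.
Proof.
split=> [Tf|f0 m fm].
  apply/mpolyP => m; rewrite mcoeff_retract mcoeff0 setCK.
  by case: ifP => // /negbT; apply: contraNeq => /Tf.
apply: contraNT fm => Tm; have := mcoeff_retract (~: T) f m.
by rewrite f0 mcoeff0 setCK (negbTE Tm) => <-.
Qed.

Lemma vars_prime_prime T : prime_ideal (vars_prime T).
Proof.
split.
- split=> [|f g /vars_primeE f0 /vars_primeE g0|a f /vars_primeE f0]; apply/vars_primeE.
  + by rewrite rmorph0.
  + by rewrite retractD f0 g0 addr0.
  + by rewrite retractM f0 mulr0.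
- by move/vars_primeE/eqP; rewrite rmorph1 oner_eq0.
move=> f g /vars_primeE/eqP; rewrite retractM mulf_eq0.
by case/orP => /eqP z; [left|right]; apply/vars_primeE.
Qed.

Lemma vars_primeX T j : vars_prime T 'X_j <-> j \in T.
Proof.
rewrite vars_primeE retractX inE; case: (j \in T) => /=; split=> // /eqP.
by rewrite -msize_poly_eq0 msizeX.
Qed.

Lemma vars_primeS S T : S \subset T -> sub_ideal (vars_prime S) (vars_prime T).
Proof.
move=> /subsetP ST f Sf m /Sf /exists_inP[j jS mj].
by apply/exists_inP; exists j => //; apply: ST.
Qed.

Lemma vars_prime_sub T P : is_ideal P -> (forall j, j \in T -> P 'X_j) ->
  sub_ideal (vars_prime T) P.
Proof.
move=> iP TP f Tf; rewrite (mpolyE f) big_seq; apply: ideal_sum => // m.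
rewrite mcoeff_msupp => /Tf /exists_inP[j jT mj].
rewrite -mul_mpolyC -(submK (_ : U_(j) <= m)%MM) ?lep1mP //.
by rewrite mpolyXD mulrA; case: iP => _ _; apply; apply: TP.
Qed.

Lemma vars_prime_coef T i f : i \notin T ->
  vars_prime T f -> coef_ideal i (vars_prime T) f.
Proof.
move=> iT /vars_primeE f0 d; apply/vars_primeE.
rewrite -xcoef_retract (setUidPr _) ?f0 ?xcoef0 //.
by rewrite sub1set inE.
Qed.

End Polynomials.

(** * The Nullstellensatz *)

Lemma maximal_ideal_inv (A : comNzRingType) (P : A -> Prop) x :
  maximal_ideal P -> ~ P x -> exists g, P (1 - g * x).
Proof.
move=> [iP P1 mP] nPx; apply: NNPP => n1; apply: nPx.
apply: (mP (add_principal P x)) => //; first exact: add_principal_ideal.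
  exact: add_principal_sub.
exact: add_principal_gen.
Qed.

Lemma maximal_ideal_prime (A : comNzRingType) (P : A -> Prop) :
  maximal_ideal P -> prime_ideal P.
Proof.
move=> mP; case: (mP) => iP P1 _; split=> // x y Pxy; apply: NNPP => /not_or_and[nx].
case: (maximal_ideal_inv mP nx) => g Pg; apply.
have -> : y = y * (1 - g * x) + g * (x * y) by ring.
by case: (iP) => _ PD PM; apply: PD; apply: PM.
Qed.

Lemma exists_maximal_set (I : finType) (Q : {set I} -> Prop) (S : {set I}) :
  Q S -> exists T, [/\ Q T, S \subset T & forall i, i \notin T -> ~ Q (i |: T)].
Proof.
have [b] := ubnP #|~: S|; elim: b S => // b IH S ltb QS.
have [[i [iS Qi]]|none] := classic (exists i, i \notin S /\ Q (i |: S)).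
  case: (IH (i |: S)) => // [|T [QT ST mT]].
    rewrite ltnS in ltb; apply: leq_trans ltb; apply: proper_card.
    rewrite properC; apply/properP; split; first exact: subsetU1.
    by exists i; rewrite ?setU11.
  by exists T; split=> //; apply: subset_trans ST; apply: subsetU1.
by exists S; split=> // i iS Qi; apply: none; exists i.
Qed.

Lemma det_ideal (A : comNzRingType) (P : A -> Prop) N (R : 'M[A]_N) (v : 'cV_N) i :
  is_ideal P -> (forall j, P ((R *m v) j 0)) -> P (\det R * v i 0).
Proof.
move=> iP Rv; have <- : (\adj R *m (R *m v)) i 0 = \det R * v i 0.
  by rewrite mulmxA mul_adj_mx mul_scalar_mx mxE.
rewrite mxE; apply: ideal_sum => // j _; case: iP => _ _; apply; exact: Rv.
Qed.

Lemma prod_congr (A : comNzRingType) (J : A -> Prop) (I : Type) (r : seq I) (x y : I -> A) :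
  is_ideal J -> (forall i, J (x i - y i)) ->
  J (\prod_(i <- r) x i - \prod_(i <- r) y i).
Proof.
move=> iJ Jxy; case: (iJ) => J0 JD JM; elim: r => [|i r IH].
  by rewrite !big_nil subrr.
rewrite !big_cons; set X := \prod_(_ <- _) _ in IH *; set Y := \prod_(_ <- _) _ in IH *.
have -> : x i * X - y i * Y = X * (x i - y i) + y i * (X - Y) by ring.
by apply: JD; apply: JM.
Qed.

Lemma det_congr (A : comNzRingType) (J : A -> Prop) N (R S : 'M[A]_N) :
  is_ideal J -> (forall i j, J (R i j - S i j)) -> J (\det R - \det S).
Proof.
move=> iJ JRS; rewrite /determinant -sumrB; apply: ideal_sum => // s _.
by rewrite -mulrBr; case: (iJ) => _ _; apply; apply: prod_congr.
Qed.

Section Nullstellensatz.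
Variables (k : fieldType) (n : nat).
Local Notation A := {mpoly k[n]}.
Implicit Types (f g h : A) (i j : 'I_n) (S T : {set 'I_n}).

(** * Integral dependence over a localised polynomial subring *)

Section NoetherNormalization.
Variables (P : A -> Prop) (iP : is_ideal P) (T : {set 'I_n}).
Variables (D : nat) (l : A).
Hypothesis lT : retract T l = l.
(** Let B be the ring of polynomials in the variables of T. Modulo P, each x_j outside T satisfies
    an equation of the common degree D over B whose leading coefficient h divides l, so it is
    integral over B[1/l]. *)
Hypothesis integral : forall j, j \notin T -> exists u h s (c : nat -> A) (m : nat -> nat),
  [/\ retract T u = u, retract T h = h, l = u * h,
      forall a, (a < s)%N -> retract T (c a) = c a /\ (m a < D)%N &
      P (h * 'X_j ^+ D - \sum_(a < s) c a * 'X_j ^+ m a)].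

Definition mono (e : {ffun 'I_n -> 'I_D}) : A := 'X_[ [multinom (e i : nat) | i < n] ].

Definition in_span f :=
  exists b : {ffun 'I_n -> 'I_D} -> A,
    (forall e, retract T (b e) = b e) /\ P (f - \sum_e b e * mono e).

(** Membership, modulo P, in the B[1/l]-span of the monomials [mono e], with the denominator
    cleared. *)
Definition in_local_span f := exists M, in_span (l ^+ M * f).

Lemma in_span_mono e : in_span (mono e).
Proof.
exists (fun e' => (e' == e)%:R); split=> [e'|].
  by case: (e' == e); rewrite ?rmorph0 ?rmorph1.
rewrite (bigD1 e) //= eqxx mul1r big1 ?addr0 ?subrr; first by case: iP.
by move=> e' /negbTE ->; rewrite mul0r.
Qed.

Lemma in_span0 : in_span 0.
Proof.
exists (fun=> 0); split=> [e|]; first by rewrite rmorph0.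
by rewrite big1 ?subr0 => [|e _]; rewrite ?mul0r //; case: iP.
Qed.

Lemma in_spanD f g : in_span f -> in_span g -> in_span (f + g).
Proof.
move=> [b [bT Pb]] [c [cT Pc]]; exists (fun e => b e + c e); split=> [e|].
  by rewrite retractD bT cT.
have -> : f + g - \sum_e (b e + c e) * mono e =
    (f - \sum_e b e * mono e) + (g - \sum_e c e * mono e).
  under eq_bigr => e _ do rewrite mulrDl.
  by rewrite big_split /=; ring.
by case: iP => _ PD _; apply: PD.
Qed.

Lemma in_spanM c f : retract T c = c -> in_span f -> in_span (c * f).
Proof.
move=> cT [b [bT Pb]]; exists (fun e => c * b e); split=> [e|].
  by rewrite retractM cT bT.
have -> : c * f - \sum_e c * b e * mono e = c * (f - \sum_e b e * mono e).
  by rewrite mulrBr mulr_sumr; congr (_ - _); apply: eq_bigr => e _; rewrite mulrA.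
by case: iP => _ _; apply.
Qed.

Lemma in_span_congr f g : P (f - g) -> in_span g -> in_span f.
Proof.
move=> Pfg [b [bT Pb]]; exists b; split=> //.
have -> : f - \sum_e b e * mono e = (f - g) + (g - \sum_e b e * mono e) by ring.
by case: iP => _ PD _; apply: PD.
Qed.

Lemma retract_lX M : retract T (l ^+ M) = l ^+ M.
Proof. by rewrite rmorphXn /= lT. Qed.

Lemma in_local_span1 f : in_span f -> in_local_span f.
Proof. by exists 0%N; rewrite expr0 mul1r. Qed.

Lemma in_local_spanD f g :
  in_local_span f -> in_local_span g -> in_local_span (f + g).
Proof.
move=> [M fM] [N gN]; exists (N + M)%N; rewrite mulrDr; apply: in_spanD.
  by rewrite exprD -mulrA; apply: in_spanM => //; apply: retract_lX.
by rewrite addnC exprD -mulrA; apply: in_spanM => //; apply: retract_lX.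
Qed.

Lemma in_local_spanM c f :
  retract T c = c -> in_local_span f -> in_local_span (c * f).
Proof. by move=> cT [M fM]; exists M; rewrite mulrCA; apply: in_spanM. Qed.

Lemma in_local_span_sum (I : Type) (r : seq I) (Q : pred I) (F : I -> A) :
  (forall a, Q a -> in_local_span (F a)) ->
  in_local_span (\sum_(a <- r | Q a) F a).
Proof.
move=> QF; apply: (big_ind in_local_span) => //; last exact: in_local_spanD.
exact/in_local_span1/in_span0.
Qed.

Lemma in_local_span_congr f g : P (f - g) -> in_local_span g -> in_local_span f.
Proof.
move=> Pfg [M gM]; exists M; apply: in_span_congr gM.
by rewrite -mulrBr; case: iP => _ _; apply.
Qed.

Lemma in_local_span_unlocal M f : in_local_span (l ^+ M * f) -> in_local_span f.
Proof. by move=> [N fN]; exists (N + M)%N; rewrite exprD -mulrA. Qed.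

(** For j outside T the integral equation is used only when the exponent reaches D; its leading
    coefficient costs one factor l. *)
Lemma in_local_spanX_mono j e : in_local_span ('X_j * mono e).
Proof.
case: (boolP (j \in T)) => jT.
  apply: in_local_spanM; first by rewrite retractX jT.
  exact/in_local_span1/in_span_mono.
pose upd (a : 'I_D) := [ffun i => if i == j then a else e i].
pose m0 : A := 'X_[ [multinom (if i == j then 0 else e i : nat)%N | i < n] ].
have updE a : mono (upd a) = 'X_j ^+ a * m0.
  rewrite /mono /m0 mpolyXn -mpolyXD; congr 'X_[_]; apply/mnmP => i.
  rewrite !mnmE mulmnE mnm1E ffunE eq_sym.
  by case: eqP => _; rewrite ?mul1n ?addn0 ?mul0n.
have eE : mono e = 'X_j ^+ e j * m0.
  by rewrite -updE; congr mono; apply/ffunP => i; rewrite ffunE; case: eqP => // ->.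
have [ltD|geD] := ltnP (e j).+1 D.
  apply: in_local_span1; rewrite eE mulrA -exprS.
  by rewrite -[_.+1]/(nat_of_ord (Ordinal ltD)) -updE; apply: in_span_mono.
have eD : (e j).+1 = D by apply/eqP; rewrite eqn_leq geD ltn_ord.
have [u [h [s [c [m [uT hT lE cm Pc]]]]]] := integral jT.
apply: (in_local_span_unlocal (M := 1)); rewrite expr1 lE -mulrA.
apply: in_local_spanM => //; rewrite eE [_ * (_ * m0)]mulrA -exprS eD mulrA.
apply: (in_local_span_congr (g := (\sum_(a < s) c a * 'X_j ^+ m a) * m0)).
  by rewrite -mulrBl; apply: idealMr.
rewrite mulr_suml; apply: in_local_span_sum => a _.
have [cT ltm] := cm a (ltn_ord a).
rewrite -mulrA -[m a]/(nat_of_ord (Ordinal ltm)) -updE.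
by apply: in_local_spanM => //; apply/in_local_span1/in_span_mono.
Qed.

Lemma in_local_spanX j f : in_local_span f -> in_local_span ('X_j * f).
Proof.
move=> [M [b [bT Pb]]]; apply: (in_local_span_unlocal (M := M)).
apply: (in_local_span_congr (g := \sum_e b e * ('X_j * mono e))).
  have -> : l ^+ M * ('X_j * f) - \sum_e b e * ('X_j * mono e) =
      'X_j * (l ^+ M * f - \sum_e b e * mono e).
    rewrite mulrBr mulr_sumr; congr (_ - _); first by rewrite mulrCA.
    by apply: eq_bigr => e _; rewrite mulrCA.
  by case: iP => _ _; apply.
by apply: in_local_span_sum => e _; apply: in_local_spanM => //; apply: in_local_spanX_mono.
Qed.

Hypothesis D_gt0 : (0 < D)%N.

Definition mono0 : {ffun 'I_n -> 'I_D} := [ffun=> Ordinal D_gt0].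

Lemma mono0E : mono mono0 = 1.
Proof. by rewrite /mono -mpolyX0; congr 'X_[_]; apply/mnmP => i; rewrite !mnmE ffunE. Qed.

Lemma in_local_span_all f : in_local_span f.
Proof.
rewrite (mpolyE f); apply: in_local_span_sum => m _; rewrite -mul_mpolyC.
apply: in_local_spanM; first exact: retractC.
rewrite mpolyXE_id; elim: (index_enum _) => [|i r IH].
  by rewrite big_nil -mono0E; apply/in_local_span1/in_span_mono.
rewrite big_cons; elim: (m i) => [|a IHa]; first by rewrite expr0 mul1r.
by rewrite exprS -mulrA; apply: in_local_spanX.
Qed.

Hypothesis indep : forall f, P (retract T f) -> retract T f = 0.

(* By the determinant trick an inverse of q modulo P is integral over B[1/l],
   where B is the ring of polynomials in the variables of T. *)
Lemma invertible_dvd_power q g : retract T q = q -> P (1 - g * q) ->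
  exists M h, l ^+ M = q * h.
Proof.
move=> qT Pq.
have [M HM] : exists M, forall e, exists b : {ffun 'I_n -> 'I_D} -> A,
    (forall e', retract T (b e') = b e') /\
    P (l ^+ M * mono e - q * \sum_e' b e' * mono e').
  have /fin_all_exists [M HM] : forall e, exists M, in_span (l ^+ M * (g * mono e)).
    by move=> e; apply: in_local_span_all.
  exists (\sum_e M e)%N => e; rewrite (bigD1 e) //= addnC.
  have [b [bT Pb]] := in_spanM (retract_lX (\sum_(i | i != e) M i)) (HM e).
  exists b; split=> //.
  have E (x y z g0 q0 s0 : A) : x * y * z - q0 * s0 =
      x * y * z * (1 - g0 * q0) + q0 * (x * (y * (g0 * z)) - s0) by ring.
  rewrite exprD (E _ _ _ g).
  by case: iP => _ PD PM; apply: PD; apply: PM.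
have /fin_all_exists [b Hb] := HM.
pose N := #|{: {ffun 'I_n -> 'I_D}}|.
pose ev (i : 'I_N) : {ffun 'I_n -> 'I_D} := enum_val i.
pose bm : 'M[A]_N := \matrix_(i, j) b (ev i) (ev j).
(* R has entries in B and kills the vector of monomials modulo P, so its determinant lies in P and,
   by [indep], is 0. Modulo q the same determinant is a power of l. *)
pose R : 'M[A]_N := (l ^+ M)%:M - q *: bm.
pose v : 'cV[A]_N := \col_i mono (ev i).
have Pdet : P (\det R).
  have := @det_ideal _ P N R v (enum_rank mono0) iP.
  rewrite [v _ _]mxE /ev enum_rankK mono0E mulr1; apply=> j.
  rewrite mulmxBl mul_scalar_mx -scalemxAl !mxE.
  have [_] := Hb (ev j); congr (P (_ - q * _)).
  rewrite (reindex ev) /=; first by apply: eq_bigr => i _; rewrite !mxE.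
  by apply: onW_bij; apply: enum_val_bij.
have RT : map_mx (retract T) R = R.
  apply/matrixP => i j; rewrite !mxE; have [bT _] := Hb (ev i).
  transitivity (retract T (l ^+ M *+ (i == j)) - retract T (q * b (ev i) (ev j))).
    exact: rmorphB.
  rewrite retractM qT bT; congr (_ - _).
  case: (i == j); last exact: rmorph0.
  exact: retract_lX.
have det0 : \det R = 0.
  by rewrite -RT det_map_mx; apply: indep; rewrite -det_map_mx RT.
have [w] : add_principal (@zero_ideal A) q (\det R - \det ((l ^+ M)%:M : 'M[A]_N)).
  apply: (det_congr (J := add_principal (@zero_ideal A) q)) => [|i j].
    apply: add_principal_ideal; split=> [//|f h -> ->|a f ->]; rewrite /zero_ideal ?addr0 //.
    by rewrite mulr0.
  exists (- bm i j); rewrite /zero_ideal !mxE.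
  by move: (l ^+ M *+ _) => z; ring.
rewrite /zero_ideal det0 sub0r det_scalar -exprM => /eqP.
rewrite subr_eq0 => /eqP E; exists (M * N)%N, (- w).
by rewrite mulrN [q * w]mulrC -E opprK.
Qed.

End NoetherNormalization.

(** Otherwise {x_i0} extends to a maximal set T of variables independent modulo P, and A / P is
    integral over B[1/l], where l is the product of the leading coefficients of the relations of the
    other variables. An element q of B outside P is invertible modulo P and hence divides a power of
    l. The choice q = 1 + x_i0 * l is prime to l and not constant, which is absurd. *)
Lemma nullstellensatz (P : A -> Prop) i0 : maximal_ideal P ->
  exists f, [/\ retract [set i0] f = f, f != 0 & P f].
Proof.
move=> mP; case: (mP) => iP P1 _; have [_ _ Pprime] := maximal_ideal_prime mP.
pose indep T := forall f, P (retract T f) -> retract T f = 0.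
apply: NNPP => no; have ind1 : indep [set i0].
  move=> f Pf; apply: NNPP => /eqP f0; apply: no.
  by exists (retract [set i0] f); split=> //; rewrite retract_id.
have [T [indT i0T maxT]] := exists_maximal_set ind1.
rewrite sub1set in i0T.
have : forall j, exists gd : A * nat, j \notin T ->
    [/\ retract (j |: T) gd.1 = gd.1, P gd.1, xcoef j gd.2 gd.1 != 0 &
        gd.1 = \sum_(a < gd.2.+1) xcoef j a gd.1 * 'X_j ^+ a].
  move=> j; case: (boolP (j \in T)) => jT; first by exists (0, 0%N).
  have [f nf] := not_all_ex_not _ _ (maxT j jT).
  have [Pf /eqP f0] := imply_to_and _ _ nf.
  have [d [d0 fE]] := xcoef_lead j f0.
  by exists (retract (j |: T) f, d) => _; rewrite retract_id.
case/fin_all_exists => gd Hgd.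
have cT j a : j \notin T -> retract T (xcoef j a (gd j).1) = xcoef j a (gd j).1.
  by move=> jT; have [gE _ _ _] := Hgd j jT; rewrite -gE xcoef_retract retract_id.
pose lc j := if j \in T then 1 else xcoef j (gd j).2 (gd j).1.
have lcT j : retract T (lc j) = lc j.
  rewrite /lc; case: (boolP (j \in T)) => jT; first by rewrite rmorph1.
  exact: cT.
have lc0 j : lc j != 0.
  rewrite /lc; case: (boolP (j \in T)) => jT; first by rewrite oner_eq0.
  by have [] := Hgd j jT.
pose l := \prod_j lc j.
have lT : retract T l = l.
  by rewrite rmorph_prod; apply: eq_bigr => j _; apply: lcT.
have l0 : l != 0 by apply/prodf_neq0 => j _; apply: lc0.
pose D := (\max_j (gd j).2).+1.
have integ j : j \notin T -> exists u h s (c : nat -> A) (m : nat -> nat),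
  [/\ retract T u = u, retract T h = h, l = u * h,
      forall a, (a < s)%N -> retract T (c a) = c a /\ (m a < D)%N &
      P (h * 'X_j ^+ D - \sum_(a < s) c a * 'X_j ^+ m a)].
  move=> jT; have [_ Pg _ gE] := Hgd j jT; set d := (gd j).2 in gE.
  have ltD : (d < D)%N by rewrite ltnS; apply: (leq_bigmax j).
  (* The relation of degree d is multiplied by x_j^(D - d), so that all variables share the degree
     D. *)
  exists (\prod_(i | i != j) lc i), (lc j), d, (fun a => - xcoef j a (gd j).1).
  exists (fun a => a + (D - d))%N; split.
  - by rewrite rmorph_prod; apply: eq_bigr => i _; apply: lcT.
  - exact: lcT.
  - by rewrite /l (bigD1 j) //= mulrC.
  - move=> a ltad; split; last by lia.
    transitivity (- retract T (xcoef j a (gd j).1)); first exact: rmorphN.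
    by rewrite cT.
  - have -> : lc j * 'X_j ^+ D - \sum_(a < d) - xcoef j a (gd j).1 * 'X_j ^+ (a + (D - d)) =
        (gd j).1 * 'X_j ^+ (D - d).
      rewrite {2}gE big_ord_recr /= mulrDl addrC; congr (_ + _).
        rewrite -sumrN mulr_suml; apply: eq_bigr => a _.
        by rewrite exprD mulNr opprK mulrA.
      by rewrite -mulrA -exprD subnKC 1?ltnW // /lc (negbTE jT).
    exact: idealMr.
pose q := 1 + 'X_i0 * l.
have q1 : q - 1 = 'X_i0 * l by rewrite /q addrC addKr.
have qT : retract T q = q by rewrite retractD rmorph1 retractM retractX i0T lT.
have szXl : (1 < msize ('X_i0 * l))%N.
  have X0 : 'X_i0 != 0 :> A by rewrite -msize_poly_eq0 msizeX.
  have szl : (0 < msize l)%N by rewrite lt0n msize_poly_eq0.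
  by rewrite msizeM // msizeX mdeg1; case: (msize l) szl.
have q0 : q != 0.
  apply/eqP => z; move: szXl; have -> : 'X_i0 * l = (-1)%:MP.
    by rewrite mpolyCN mpolyC1 -[LHS](addKr 1) -/q z addr0.
  by rewrite msizeC; case: eqP.
have nPq : ~ P q by rewrite -qT => /indT; rewrite qT; apply/eqP.
have [g Pg] := maximal_ideal_inv mP nPq.
have [M [h lMq]] := invertible_dvd_power iP lT integ (ltn0Sn _) indT qT Pg.
(* Modulo q the element (q - 1)^M = x_i0^M * l^M is 0 and also (-1)^M, so q is a unit. *)
have [u uE] : exists u, (q - 1) ^+ M = q * u + (-1) ^+ M.
  exists (\sum_(i < M) (q - 1) ^+ (M.-1 - i) * (-1) ^+ i).
  by apply/eqP; rewrite -subr_eq subrXX opprK subrK.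
have qw : q * ((-1) ^+ M * ('X_i0 ^+ M * h - u)) = 1.
  have E : q * ('X_i0 ^+ M * h) = q * u + (-1) ^+ M.
    by rewrite -uE q1 exprMn lMq mulrCA.
  have -> : q * ((-1) ^+ M * ('X_i0 ^+ M * h - u)) =
    (-1) ^+ M * (q * ('X_i0 ^+ M * h) - q * u) by ring.
  by rewrite E addrC addKr -exprMn mulrNN mulr1 expr1n.
set w := (-1) ^+ M * _ in qw.
have w0 : w != 0 by apply: contra_eq_neq qw => ->; rewrite mulr0 eq_sym oner_eq0.
have szq : msize q = 1%N.
  have := congr1 (fun f : A => msize f) qw; rewrite msizeM // msize1.
  move: q0 w0; rewrite -!msize_poly_eq0.
  by move: (msize q) (msize w) => x y; lia.
move: szXl; rewrite -q1; apply/negP; rewrite -leqNgt; apply: leq_trans (msizeD_le _ _) _.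
by rewrite szq msizeN msize1.
Qed.

End Nullstellensatz.

(** * Heights and depths *)

Section ElementarySymmetric.
Variables (A : comNzRingType) (n : nat) (y : 'I_n -> A).
Implicit Types (J : A -> Prop) (F G : {set 'I_n}).

Definition elem_sym j : A := \sum_(B : {set 'I_n} | #|B| == j) \prod_(i in B) y i.

(** The order is descending because e_m is the product of the remaining y_i when all but m of them
    vanish. *)
Fixpoint elem_syms m : seq A := if m is m'.+1 then elem_sym m :: elem_syms m' else [::].

Lemma size_elem_syms m : size (elem_syms m) = m.
Proof. by elim: m => //= m ->. Qed.

Lemma mem_elem_syms P m x : is_ideal P -> (forall i, P (y i)) -> x \in elem_syms m -> P x.
Proof.
move=> iP yP; elim: m => //= m IH; rewrite inE => /predU1P[->|//].
apply: ideal_sum => // B /eqP cB.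
have [i iB] : exists i, i \in B by apply/set0Pn; rewrite -card_gt0 cB.
by rewrite (bigD1 i) //=; apply: idealMr.
Qed.

Definition add_span J G : A -> Prop :=
  fun f => exists c : 'I_n -> A, J (f - \sum_(i in G) c i * y i).

(** Weak regularity in every order, a property that survives killing any one y_i with i in F. *)
Definition permutably_regular J F : Prop :=
  forall G i, G \subset F -> i \in F -> i \notin G -> nzd_mod (add_span J G) (y i).

Lemma add_span0 J f : add_span J set0 f <-> J f.
Proof.
split=> [[c]|Jf]; first by rewrite big_set0 subr0.
by exists (fun=> 0); rewrite big_set0 subr0.
Qed.

Lemma add_span_principal J i G f : i \notin G ->
  add_span (add_principal J (y i)) G f <-> add_span J (i |: G) f.
Proof.
move=> iG; split=> [[c [g Jf]]|[c]].
  exists (fun j => if j == i then g else c j); rewrite big_setU1 //= eqxx.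
  rewrite (eq_bigr (fun j => c j * y j)); first by rewrite opprD addrCA addrC.
  by move=> j jG; case: eqP jG iG => // -> ->.
rewrite big_setU1 //= => Jf; exists c, (c i).
by rewrite -addrA -opprD [_ + c i * _]addrC.
Qed.

Lemma permutably_regular_add J F i : permutably_regular J F -> i \in F ->
  permutably_regular (add_principal J (y i)) (F :\ i).
Proof.
move=> rJ iF G j; rewrite subsetD1 !inE => /andP[GF iG] /andP[ji jF] jG.
apply: (eq_nzd_mod (J := add_span J (i |: G))) => [f|].
  by split=> /(add_span_principal _ _ iG).
by apply: rJ => //; rewrite ?subUset ?sub1set ?iF ?GF // !inE negb_or ji.
Qed.

Lemma nzd_mod_prod J F : (forall i, i \in F -> nzd_mod J (y i)) ->
  nzd_mod J (\prod_(i in F) y i).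
Proof.
move=> nJ; elim/big_ind: _ => // [f|a b na nb f]; first by rewrite mul1r.
by rewrite -mulrA => /na /nb.
Qed.

Lemma nzd_mod_congr J a b : is_ideal J -> J (a - b) -> nzd_mod J b -> nzd_mod J a.
Proof.
move=> iJ Jab nb f Jaf; apply: nb.
have -> : b * f = a * f - (a - b) * f by ring.
by apply: idealB => //; apply: idealMr.
Qed.

Lemma add_principal_congr J a b f : is_ideal J -> J (a - b) ->
  add_principal J a f -> add_principal J b f.
Proof.
move=> iJ Jab [g Jf]; exists g.
have -> : f - g * b = f - g * a + g * (a - b) by ring.
by case: (iJ) => _ JD JM; apply: JD => //; apply: JM.
Qed.

Lemma elem_sym_congr J F m : is_ideal J -> (forall i, i \notin F -> J (y i)) ->
  #|F| = m -> J (elem_sym m - \prod_(i in F) y i).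
Proof.
move=> iJ yJ cF; rewrite /elem_sym (bigD1 F) ?cF //= addrAC subrr add0r.
apply: ideal_sum => // B /andP[/eqP cB nBF].
have /subsetPn [i iB iF] : ~~ (B \subset F).
  by apply: contra nBF => BF; rewrite eqEcard BF cF cB leqnn.
by rewrite (bigD1 i) //=; apply: idealMr => //; apply: yJ.
Qed.

(* Modulo J + (y_i) the functions e_(m-1), ..., e_1 become those of one
   variable less, and J + (prod_(i in F) y_i) is filtered by colon ideals with
   respect to the y_i. *)
Lemma weakly_regular_elem_syms J F m : is_ideal J -> #|F| = m ->
  (forall i, i \notin F -> J (y i)) -> permutably_regular J F ->
  weakly_regular J (elem_syms m).
Proof.
elim: m J F => // m IH J F iJ cF yJ rJ.
have nJ i : i \in F -> nzd_mod J (y i).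
  move=> iF; apply: (eq_nzd_mod (add_span0 J)).
  by apply: rJ; rewrite ?sub0set ?inE.
have Je := elem_sym_congr iJ yJ cF.
split; first by apply: nzd_mod_congr Je _ => //; apply: nzd_mod_prod.
apply: (eq_weakly_regular (J := add_principal J (\prod_(i in F) y i))) => [f|].
  split; apply: add_principal_congr => //.
  by rewrite -opprB; apply: idealN.
rewrite -/(elem_syms m) -big_enum /=.
have : {subset enum F <= F} by move=> i; rewrite mem_enum.
(* One factor is split off at a time: (J + (y_i z)) : y_i is J + (z), handled by the inner
   induction, and J + (y_i z) + (y_i) is J + (y_i), handled by the outer one with F minus i. The
   empty product gives the unit ideal. *)
elim: (enum F) => [|i r IHr] rF.
  rewrite big_nil; apply: weakly_regular_top => f.
  by exists f; rewrite mulr1 subrr; case: iJ.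
have iF : i \in F by apply: rF; rewrite mem_head.
rewrite big_cons; set z := \prod_(_ <- _) _ in IHr *.
apply: (weakly_regular_split (x := y i)); first exact: add_principal_ideal.
  apply: (eq_weakly_regular (J := add_principal J z)) => [f|].
    split=> [] [g Jg]; exists g.
      have -> : y i * f - g * (y i * z) = y i * (f - g * z) by ring.
      by case: iJ => _ _; apply.
    apply: (nJ i iF); move: Jg.
    by have -> : y i * f - g * (y i * z) = y i * (f - g * z) by ring.
  by apply: IHr => j jr; apply: rF; rewrite inE jr orbT.
apply: (eq_weakly_regular (J := add_principal J (y i))) => [f|].
  split=> [[g Jg]|[g [h Jg]]].
    by exists g; apply: add_principal_sub.
  exists (g + h * z); congr (J _): Jg; ring.
apply: (IH _ (F :\ i)).
- exact: add_principal_ideal.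
- by have := cardsD1 i F; rewrite iF cF => -[].
- move=> j; rewrite !inE negb_and negbK => /orP[/eqP ->|/yJ].
    exact: add_principal_gen.
  exact: add_principal_sub.
- exact: permutably_regular_add.
Qed.

End ElementarySymmetric.

Lemma nth_notin_take (T : eqType) (x : T) (s : seq T) i :
  uniq s -> (i < size s)%N -> nth x s i \notin take i s.
Proof.
move=> us ltis; have : uniq (take i s ++ drop i s) by rewrite cat_take_drop.
by rewrite (drop_nth x ltis) cat_uniq /= negb_or => /and3P[_ /andP[]].
Qed.

(** * Depth and height from primes generated by variables *)

Section CohenMacaulay.
Variables (k : fieldType) (n : nat).
Local Notation A := {mpoly k[n]}.
Implicit Types (I P : A -> Prop) (T : {set 'I_n}).

Lemma add_span_ideal (y : 'I_n -> A) (J : A -> Prop) (G : {set 'I_n}) :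
  is_ideal J -> is_ideal (add_span y J G).
Proof.
move=> [J0 JD JM]; split.
- by exists (fun=> 0); rewrite big1 ?subr0 // => i _; rewrite mul0r.
- move=> f g [c Jc] [d Jd]; exists (fun i => c i + d i).
  under eq_bigr => i _ do rewrite mulrDl.
  by rewrite big_split /= opprD addrACA; apply: JD.
- move=> a f [c Jc]; exists (fun i => a * c i).
  under eq_bigr => i _ do rewrite -mulrA.
  by rewrite -mulr_sumr -mulrBr; apply: JM.
Qed.

Lemma xcoefM_free (i : 'I_n) d (f g : A) (S : {set 'I_n}) : i \notin S -> retract S g = g ->
  xcoef i d (f * g) = xcoef i d f * g.
Proof.
move=> iS gS; rewrite xcoefM big_ord_recr /= subnn (xcoef_free 0 iS gS) eqxx.
rewrite big1 ?add0r // => e _; rewrite (xcoef_free _ iS gS).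
by rewrite -[_ == 0%N]negbK -lt0n subn_gt0 ltn_ord mulr0.
Qed.

Lemma xcoef_sum i d (G : {set 'I_n}) (F : 'I_n -> A) :
  xcoef i d (\sum_(j in G) F j) = \sum_(j in G) xcoef i d (F j).
Proof.
by elim/big_rec2: _ => [|j a b _ <-]; rewrite ?xcoef0 ?xcoefD.
Qed.

(** For i outside T and G, the ideal generated by the variables of T and the y_j with j in G is
    closed under taking coefficients with respect to x_i, so a nonzero polynomial in x_i alone is a
    nonzerodivisor modulo it. *)
Lemma permutably_regular_vars (y : 'I_n -> A) T :
  (forall i, retract [set i] (y i) = y i) -> (forall i, y i != 0) ->
  permutably_regular y (vars_prime T) (~: T).
Proof.
move=> yi y0 G i _; rewrite inE => iT iG.
have [iV _ _] := vars_prime_prime k T.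
apply: nzd_mod_univariate (yi i) (y0 i); first exact: add_span_ideal.
move=> f [c Vf] d; exists (fun j => xcoef i d (c j)).
have -> : xcoef i d f - \sum_(j in G) xcoef i d (c j) * y j =
    xcoef i d (f - \sum_(j in G) c j * y j).
  have -> : - (\sum_(j in G) c j * y j) = \sum_(j in G) (- c j) * y j.
    by rewrite -sumrN; apply: eq_bigr => j _; rewrite mulNr.
  rewrite xcoefD xcoef_sum -sumrN; congr (_ + _); apply: eq_bigr => j jG.
  have ji : i \notin [set j] by rewrite inE; apply: contraNneq iG => ->.
  rewrite (xcoefM_free d _ ji (yi j)) -mulNr; congr (_ * _).
  apply/eqP; rewrite eq_sym -addr_eq0 addrC -xcoefD subrr.
  by rewrite xcoef0.
exact: vars_prime_coef.
Qed.

(** Multiplying by x_i makes y_i vanish modulo every [vars_prime T] with i in T, so one choice of y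
    serves all minimal primes. *)
Lemma maximal_ideal_parameters P : maximal_ideal P -> exists y : 'I_n -> A,
  forall i, [/\ retract [set i] (y i) = y i, y i != 0, P (y i) &
                forall T, i \in T -> vars_prime T (y i)].
Proof.
move=> mP; have [f Hf] := fin_all_exists (fun i => nullstellensatz i mP).
exists (fun i => f i * 'X_i) => i; have [fi f0 Pf] := Hf i; split.
- by rewrite retractM fi retractX inE eqxx.
- by rewrite mulf_neq0 // -msize_poly_eq0 msizeX.
- by case: mP => iP _ _; apply: idealMr.
- move=> T iT; have [[_ _ VM] _ _] := vars_prime_prime k T.
  by apply: VM; apply/vars_primeX.
Qed.

Lemma prime_nzd P x : prime_ideal P -> ~ P x -> nzd_mod P x.
Proof. by move=> [_ _ pP] nPx f /pP []. Qed.

(** Prepares a chain for [flag_length]: an element outside a prime is a nonzerodivisor modulo it. *)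
Lemma prime_chain_flag I P m : prime_chain I P m ->
  exists (J : nat -> A -> Prop) (y : nat -> A),
  [/\ sub_ideal I (J 0%N), forall x, J m x <-> P x,
      forall i, (i <= m)%N -> prime_ideal (J i),
      forall i, (i < m)%N -> sub_ideal (J i) (J i.+1) &
      forall i, (i < m)%N -> J i.+1 (y i) /\ ~ J i (y i)].
Proof.
move=> [p [pp Ip lt pP]].
exists p, (fun i => epsilon (inhabits 0) (fun x => p i.+1 x /\ ~ p i x)).
split=> // i ltim; first by case: (lt i ltim).
apply: (epsilon_spec (inhabits 0) (fun x => p i.+1 x /\ ~ p i x)).
have [_ nsub] := lt i ltim.
have [x nx] := not_all_ex_not _ _ nsub.
by exists x; apply: imply_to_and nx.
Qed.

Lemma prime_chain_length I P d m (Fs : seq {set 'I_n}) :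
  is_ideal I -> (forall F, F \in Fs -> (#|F| <= d)%N) ->
  (forall m : 'X_{1..n}, I 'X_[m] \/
     exists2 F, F \in Fs & forall i, i \notin F -> m i = 0%N) ->
  prime_chain I P m -> (m <= d)%N.
Proof.
move=> iI cF sF /prime_chain_flag [J [y [IJ JP pJ sJ yJ]]].
apply: (flag_length (y := y) iI cF sF IJ) => //.
- by move=> i /pJ [].
- by move=> i /yJ [].
- by move=> i ltim; apply: prime_nzd; [apply/pJ/ltnW|case: (yJ i ltim)].
- by case: (pJ m (leqnn m)).
Qed.

Lemma adjoin_ideal_ideal I s : is_ideal I -> is_ideal (adjoin_ideal I s).
Proof.
elim: s I => [|x s IH] I iI.
  case: (iI) => I0 ID IM; split.
  - exact/adjoin_ideal_nil.
  - by move=> f g /adjoin_ideal_nil If /adjoin_ideal_nil Ig; apply/adjoin_ideal_nil; apply: ID.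
  - by move=> a f /adjoin_ideal_nil If; apply/adjoin_ideal_nil; apply: IM.
have [K0 KD KM] := IH _ (add_principal_ideal x iI); split.
- exact/adjoin_ideal_cons.
- by move=> f g /adjoin_ideal_cons If /adjoin_ideal_cons Ig; apply/adjoin_ideal_cons; apply: KD.
- by move=> a f /adjoin_ideal_cons If; apply/adjoin_ideal_cons; apply: KM.
Qed.

Lemma adjoin_ideal_sub I s f : I f -> adjoin_ideal I s f.
Proof.
move=> If; exists f => //; exists (fun=> 0).
by rewrite big1 ?addr0 // => i _; rewrite mul0r.
Qed.

Lemma adjoin_ideal_mem I s x : is_ideal I -> x \in s -> adjoin_ideal I s x.
Proof.
elim: s I => // z s IH I iI; rewrite inE => /predU1P[->|xs]; apply/adjoin_ideal_cons.
  by apply: adjoin_ideal_sub; apply: add_principal_gen.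
by apply: IH xs; apply: add_principal_ideal.
Qed.

Lemma regular_sequence_length I d s (Fs : seq {set 'I_n}) :
  is_ideal I -> (forall F, F \in Fs -> (#|F| <= d)%N) ->
  (forall m : 'X_{1..n}, I 'X_[m] \/
     exists2 F, F \in Fs & forall i, i \notin F -> m i = 0%N) ->
  regular_sequence I s -> (size s <= d)%N.
Proof.
move=> iI cF sF [rs s1].
apply: (flag_length (J := fun i => adjoin_ideal I (take i s)) (y := fun i => s`_i) iI cF sF).
- by move=> f; apply: adjoin_ideal_sub.
- by move=> i _; apply: adjoin_ideal_ideal.
- move=> i ltis f; apply: adjoin_idealP; first exact: adjoin_ideal_ideal.
    by move=> g; apply: adjoin_ideal_sub.
  move=> x xs; apply: adjoin_ideal_mem => //.
  by rewrite (take_nth 0 ltis) mem_rcons inE xs orbT.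
- move=> i ltis; apply: adjoin_ideal_mem => //.
  by rewrite (take_nth 0 ltis) mem_rcons mem_head.
- by move=> i ltis f; apply: rs.
- by rewrite take_size.
Qed.

(* Replacing P successively by the ideals of polynomials whose coefficients with
   respect to x_i lie in P, for x_i outside T, gives a chain from an ideal
   containing the variables of T up to P. *)
Lemma maximal_ideal_chain I P T : maximal_ideal P ->
  (forall j, j \in T -> P 'X_j) -> sub_ideal I (vars_prime T) ->
  prime_chain I P #|~: T|.
Proof.
move=> mP TP IT; have [y Hy] := maximal_ideal_parameters mP.
have pP := maximal_ideal_prime mP; have [iP _ _] := pP.
pose L := enum (~: T); have sL : size L = #|~: T| by rewrite -cardE.
have uL : uniq L by apply: enum_uniq.
pose E r := foldr (@coef_ideal k n) P r.
have pE r : prime_ideal (E r).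
  by elim: r => [|i r IHr]; [apply: pP|apply: coef_ideal_prime].
have TE r : {subset r <= L} -> sub_ideal (vars_prime T) (E r).
  elim: r => [|i r IHr] rL; first exact: vars_prime_sub.
  move=> f Tf d; apply: IHr; first by move=> j jr; apply: rL; rewrite inE jr orbT.
  apply: vars_prime_coef Tf _.
  by have := rL i (mem_head _ _); rewrite mem_enum inE.
(* y_i stays in the ideal until x_i is processed and leaves it at that step, which makes the
   inclusions strict. *)
have yE i r : i \notin r -> E r (y i).
  have [yi y0 Py _] := Hy i.
  elim: r => //= j r IHr; rewrite inE negb_or => /andP[ij ir].
  have [iE _ _] := pE r.
  by apply: (coef_ideal_free (S := [set i])) => //; rewrite ?inE 1?eq_sym //; apply: IHr.
rewrite -sL; exists (fun i => E (drop i L)); split=> // [|i ltis|x].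
- move=> f /IT; apply: TE => j; exact: mem_drop.
- have i0 : 'I_n by case: (L) ltis.
  rewrite (drop_nth i0 ltis) /=; set j := nth i0 L i.
  have jr : j \notin drop i.+1 L.
    by have := drop_uniq i uL; rewrite (drop_nth i0 ltis) /= => /andP[].
  have [iE _ _] := pE (drop i.+1 L).
  split=> [f|sub]; first exact: coef_idealW.
  have [yi y0 _ _] := Hy j.
  exact: (not_coef_ideal_univariate (pE _) yi y0) (sub _ (yE _ _ jr)).
- by rewrite drop_size.
Qed.

Lemma cohen_macaulay_criterion I d (Fs : seq {set 'I_n}) :
  is_ideal I -> (forall F, F \in Fs -> (#|F| <= d)%N) ->
  (forall m : 'X_{1..n}, I 'X_[m] \/
     exists2 F, F \in Fs & forall i, i \notin F -> m i = 0%N) ->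
  (forall P, prime_ideal P -> sub_ideal I P -> exists T,
     [/\ #|~: T| = d, forall j, j \in T -> P 'X_j & sub_ideal I (vars_prime T)]) ->
  (forall s, (forall T, #|~: T| = d -> weakly_regular (vars_prime T) s) ->
     weakly_regular I s) ->
  cohen_macaulay I.
Proof.
move=> iI cF sF minI wI P mP IP; exists d.
have pP := maximal_ideal_prime mP; have [iP _ _] := pP.
have [y Hy] := maximal_ideal_parameters mP.
split; split.
- exists (elem_syms y d); split; first exact: size_elem_syms.
    by move=> x; apply: mem_elem_syms => // i; case: (Hy i).
  apply: (regular_sequence_in_prime pP IP).
    by move=> x; apply: mem_elem_syms => // i; case: (Hy i).
  apply: wI => T cT; have [iV _ _] := vars_prime_prime k T.
  apply: (weakly_regular_elem_syms iV cT) => [i|].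
    by rewrite inE negbK => iT; have [_ _ _] := Hy i; apply.
  by apply: permutably_regular_vars => i; case: (Hy i).
- by move=> s _; apply: regular_sequence_length cF sF.
- by have [T [<- TP IT]] := minI P pP IP; apply: maximal_ideal_chain.
- by move=> m; apply: prime_chain_length cF sF.
Qed.

Lemma zero_ideal_ideal (R : comNzRingType) : is_ideal (@zero_ideal R).
Proof. by split=> [|f g -> ->|a f ->]; rewrite /zero_ideal ?addr0 ?mulr0. Qed.

Lemma vars_chain P T : prime_ideal P -> (forall j, j \in T -> P 'X_j) ->
  prime_chain (@zero_ideal A) P #|T|.
Proof.
move=> pP TP; have [iP _ _] := pP; pose S i := [set j in take i (enum T)].
(* The last term is P rather than [vars_prime T], so that the chain ends at P even if P is larger.
   The last inclusion is still strict, since the last variable of T is missing before it. *)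
exists (fun i => if (i < #|T|)%N then vars_prime (S i) else P); split.
- by move=> i _; case: ifP => _ //; apply: vars_prime_prime.
- move=> f ->; case: ifP => _; last by case: iP.
  by have [[]] := vars_prime_prime k (S 0%N).
- move=> i ltiT; rewrite ltiT.
  have ltie : (i < size (enum T))%N by rewrite -cardE.
  have i0 : 'I_n by case: (enum T) ltie.
  set j := nth i0 (enum T) i.
  have jT : j \in T by rewrite -mem_enum mem_nth.
  have Sj : S i.+1 = j |: S i.
    by apply/setP => z; rewrite !inE (take_nth i0 ltie) mem_rcons inE.
  have jS : j \notin S i by rewrite inE; apply: nth_notin_take (enum_uniq T) ltie.
  case: ifP => _; split.
  + by apply: vars_primeS; rewrite Sj subsetU1.
  + by move/(_ 'X_j); rewrite !vars_primeX Sj setU11 => /(_ isT); apply/negP.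
  + apply: vars_prime_sub => // z; rewrite inE => /mem_take.
    by rewrite mem_enum; apply: TP.
  + by move/(_ 'X_j (TP j jT)) /vars_primeX; apply/negP.
- by move=> x; rewrite ltnn.
Qed.

(** For the upper bound, a chain of length m ending at this prime is prolonged by adjoining the n -
    |T| other variables one by one. The result is a flag in the polynomial ring, of length at most
    n. *)
Lemma vars_prime_height T : has_height (@zero_ideal A) (vars_prime T) #|T|.
Proof.
split; first by apply: vars_chain; [apply: vars_prime_prime|move=> j /vars_primeX].
move=> m /prime_chain_flag [J [y [IJ JP pJ sJ yJ]]].
pose L := enum (~: T); have sL : size L = (n - #|T|)%N.
  by rewrite -cardE cardsCs setCK card_ord.
have leT : (#|T| <= n)%N by have := max_card (mem T); rewrite card_ord.
suff : (m + size L <= n)%N by rewrite sL; lia.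
pose S i := T :|: [set j in take i L].
pose K i := if (i <= m)%N then J i else vars_prime (S (i - m)%N).
have KE i : K (m + i)%N = vars_prime (S i) \/ i = 0%N /\ K (m + i)%N = J m.
  rewrite /K; case: i => [|i]; [right|left].
    by rewrite addn0 leqnn.
  by rewrite leqNgt addnS ltnS leq_addr /= -addnS addKn.
have Km f i : K (m + i)%N f <-> vars_prime (S i) f.
  case: (KE i) => [->//|[-> ->]]; rewrite JP.
  suff -> : S 0%N = T by [].
  by apply/setP => j; rewrite !inE take0 orbF.
have pK i : prime_ideal (K i).
  rewrite /K; case: ifP => [/pJ //|_]; exact: vars_prime_prime.
have step a : (a < size L)%N -> exists j : 'I_n,
    [/\ nth 0 [seq 'X_i : A | i <- L] a = 'X_j, j \notin S a & S a.+1 = j |: S a].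
  move=> lta; have j0 : 'I_n by case: (L) lta.
  exists (nth j0 L a); rewrite (nth_map j0) //; split=> //.
    rewrite !inE negb_or -[_ \notin T]in_setC -mem_enum mem_nth //=.
    by apply: nth_notin_take => //; apply: enum_uniq.
  by apply/setP => i; rewrite !inE (take_nth j0 lta) mem_rcons inE orbCA.
pose z i := if (i < m)%N then y i else nth 0 [seq 'X_j | j <- L] (i - m).
have Kz i : (i < m + size L)%N ->
    [/\ sub_ideal (K i) (K i.+1), K i.+1 (z i) & ~ K i (z i)].
  move=> lti; have [ltim|lemi] := ltnP i m.
    rewrite /K /z ltim ltnW //; have [y1 y2] := yJ i ltim.
    by split=> //; apply: sJ.
  have [a ia] : exists a, i = (m + a)%N by exists (i - m)%N; rewrite subnKC.
  rewrite ia ltn_add2l in lti; have [j [zj jS Sj]] := step a lti.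
  rewrite /z ia ltnNge leq_addr /= addKn zj -addnS; split.
  - move=> f /Km Sf; apply/Km; apply: vars_primeS Sf.
    by rewrite Sj subsetU1.
  - by apply/Km/vars_primeX; rewrite Sj setU11.
  - by move/Km/vars_primeX; apply/negP.
apply: (flag_length (I := @zero_ideal A) (Fs := [:: setT]) (J := K) (y := z)).
- exact: zero_ideal_ideal.
- by move=> F; rewrite inE => /eqP ->; rewrite cardsT card_ord.
- by move=> e; right; exists setT; rewrite ?mem_head // => i; rewrite inE.
- exact: IJ.
- by move=> i _; case: (pK i).
- by move=> i /Kz [].
- by move=> i /Kz [].
- by move=> i /Kz [_ _]; apply: prime_nzd.
- by case: (pK (m + size L)%N).
Qed.

End CohenMacaulay.

(** * Vertex decomposable monomial ideals *)

Section MonomialIdeals.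
Variables (k : fieldType) (n : nat).
Local Notation A := {mpoly k[n]}.
Implicit Types (D : 'X_{1..n} -> bool) (f : A).

Lemma monomial_idealX D (m : 'X_{1..n}) : D m -> monomial_ideal D ('X_[m] : A).
Proof. by move=> Dm e; rewrite mcoeffX; case: (m =P e) => [<-|]; rewrite ?eqxx. Qed.

Lemma mcoeffM_neq0 f g m : (f * g)@_m != 0 -> exists u v, g@_v != 0 /\ m = (u + v)%MM.
Proof.
rewrite -mcoeff_msupp => /msuppM_le /allpairsP [[u v] /= [_ vg ->]].
by exists u, v; rewrite -mcoeff_msupp.
Qed.

Lemma monomial_ideal_ideal D : (forall m e, D m -> D (e + m)%MM) ->
  is_ideal (@monomial_ideal k n D).
Proof.
move=> DD; split.
- by move=> m; rewrite mcoeff0 eqxx.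
- move=> f g Df Dg m; rewrite mcoeffD => fg.
  have [f0|] := eqVneq f@_m 0; last exact: Df.
  by apply: Dg; apply: contraNneq fg => g0; rewrite f0 g0 addr0.
- move=> f g Dg m fg.
  have [u [v [gv ->]]] := @mcoeffM_neq0 f g m fg.
  apply: DD.
  exact: (Dg v gv).
Qed.

Lemma monomial_ideal_sub D (J : A -> Prop) : is_ideal J ->
  (forall m, D m -> J 'X_[m]) -> sub_ideal (monomial_ideal D) J.
Proof.
move=> iJ DJ f Df; rewrite (mpolyE f) big_seq; apply: ideal_sum => // m.
rewrite mcoeff_msupp => /Df /DJ Jm; rewrite -mul_mpolyC.
by case: iJ => _ _; apply.
Qed.

Lemma eq_monomial_ideal D E f : D =1 E -> monomial_ideal D f <-> monomial_ideal E f.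
Proof. by move=> eDE; split=> Df m /Df; rewrite eDE. Qed.

Lemma colon_monomial_ideal D j f :
  colon (monomial_ideal D) 'X_j f <-> monomial_ideal (fun m => D (m + U_(j))%MM) f.
Proof.
rewrite /colon mulrC; split=> Df m.
  by rewrite -(mcoeffMX f U_(j)%MM m) addmC; apply: Df.
rewrite -mcoeff_msupp (perm_mem (msuppMX f _)) => /mapP [e ef ->].
by rewrite addmC; apply: Df; rewrite -mcoeff_msupp.
Qed.

Lemma add_principal_monomial_ideal D j f : (forall m e, D m -> D (e + m)%MM) ->
  add_principal (monomial_ideal D) 'X_j f <->
  monomial_ideal (fun m => (m j != 0%N) || D m) f.
Proof.
move=> DD; have iD := monomial_ideal_ideal DD; split; last first.
  apply: monomial_ideal_sub; first exact: add_principal_ideal.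
  move=> m /orP[mj|Dm]; last by apply: add_principal_sub; apply: monomial_idealX.
  rewrite -(submK (_ : U_(j) <= m)%MM) ?lep1mP // mpolyXD.
  have [_ _ KM] := add_principal_ideal ('X_j : A) iD.
  by apply: KM; apply: add_principal_gen.
have iE : is_ideal (@monomial_ideal k n (fun m => (m j != 0%N) || D m)).
  apply: monomial_ideal_ideal => m e /orP[mj|Dm]; apply/orP; [left|right].
    by rewrite mnmDE addn_eq0 negb_and mj orbT.
  exact: DD.
move=> [g Df]; apply: (@ideal_subl _ _ f (g * 'X_j) iE).
  case: iE => _ _; apply; apply: monomial_idealX.
  by rewrite mnm1E eqxx.
by move=> m /Df ->; rewrite orbT.
Qed.

Lemma prime_monomial (P : A -> Prop) m :
  prime_ideal P -> P 'X_[m] -> exists2 j, P 'X_j & m j != 0%N.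
Proof.
move=> [iP P1 pP]; rewrite mpolyXE_id => Pm; apply: NNPP => no; apply: P1; move: Pm.
elim: (index_enum _) => [|i r IH]; first by rewrite big_nil.
rewrite big_cons; case: (posnP (m i)) => [->|mi]; first by rewrite expr0 mul1r.
case/pP => [|//]; elim: (m i) => // a IHa; rewrite exprS => /pP[Pi|//].
by exfalso; apply: no; exists i; rewrite -?lt0n.
Qed.

Lemma span_ideal_ideal (R : comNzRingType) (J : finType) (F : J -> R) :
  is_ideal (span_ideal F).
Proof.
split.
- by exists (fun=> 0); rewrite big1 // => j _; rewrite mul0r.
- move=> f g [c ->] [d ->]; exists (fun j => c j + d j).
  by rewrite -big_split; apply: eq_bigr => j _; rewrite mulrDl.
- move=> a f [c ->]; exists (fun j => a * c j).
  by rewrite mulr_sumr; apply: eq_bigr => j _; rewrite mulrA.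
Qed.

Lemma span_ideal_gen (R : comNzRingType) (J : finType) (F : J -> R) j :
  span_ideal F (F j).
Proof.
exists (fun i => (i == j)%:R).
by rewrite (bigD1 j) //= eqxx mul1r big1 ?addr0 // => i /negbTE ->; rewrite mul0r.
Qed.

Lemma label_idealE (a : labelling n) f :
  label_ideal a f <-> monomial_ideal (fun m => [exists u, (a u <= m)%MM]) f.
Proof.
split; last first.
  apply: monomial_ideal_sub; first exact: span_ideal_ideal.
  move=> m /existsP [u aum]; rewrite -(submK aum) mpolyXD.
  by have [_ _ SM] := span_ideal_ideal (fun u => 'X_[k, a u]); apply: SM; apply: span_ideal_gen.
have iM : is_ideal (@monomial_ideal k n (fun m => [exists u, (a u <= m)%MM])).
  apply: monomial_ideal_ideal => m e /existsP [u aum]; apply/existsP; exists u.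
  by apply: lepm_trans aum (lem_addl _ _).
move=> [c ->]; apply: ideal_sum => // u _; case: (iM) => _ _; apply.
by apply: monomial_idealX; apply/existsP; exists u; apply: lepm_refl.
Qed.

End MonomialIdeals.

(** * Certificates of vertex decomposability *)

Inductive split_tree := Leaf | Split of nat & split_tree & split_tree.

(* t exhibits the squarefree monomial ideal in n variables generated by gens as
   vertex decomposable with all minimal primes generated by c variables *)
Fixpoint decomposes (n c : nat) (t : split_tree) (gens : seq (seq nat)) : bool :=
  match t with
  | Leaf =>
    let T := [seq j <- iota 0 n | [:: j] \in gens] in
    (size T == c) && all (has (mem T)) gens
  | Split x l r =>
    [&& (x < n)%N, decomposes n c l [seq [seq j <- g | j != x] | g <- gens]
      & decomposes n c r ([:: x] :: gens)]
  end.

(** Through the default 0 of [nth], a generator with an index beyond the last variable divides no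
    monomial. *)
Definition covered (gens : seq (seq nat)) n (m : 'X_{1..n}) : bool :=
  has (all (fun j => nth 0%N m j != 0%N)) gens.

Lemma coveredD gens n (m e : 'X_{1..n}) : covered gens m -> covered gens (e + m)%MM.
Proof.
apply: sub_has => g; apply: sub_all => j.
have [ltj|gej] := ltnP j n; last by rewrite nth_default ?size_tuple.
have nthE (m' : 'X_{1..n}) : nth 0%N m' j = m' (Ordinal ltj) by rewrite (mnm_nth 0%N).
by rewrite !nthE mnmDE addn_eq0 negb_and => ->; rewrite orbT.
Qed.

Lemma card_ord_filter n (S : pred nat) :
  #|[set i : 'I_n | S i]| = size [seq j <- iota 0 n | S j].
Proof.
transitivity (\sum_(0 <= i < n | S i) 1)%N; first by rewrite big_mkord sum1dep_card.
by rewrite size_filter -sum1_count /index_iota subn0.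
Qed.

(** Deleting x from the generators gives the colon ideal by x, and adding [:: x] gives the sum with
    (x), so each split is an instance of [weakly_regular_split]. At a leaf the ideal is generated by
    c variables. *)
Lemma decomposes_regular (k : fieldType) n c t gens (s : seq {mpoly k[n]}) :
  decomposes n c t gens ->
  (forall T : {set 'I_n}, #|T| = c -> weakly_regular (vars_prime T) s) ->
  weakly_regular (monomial_ideal (covered gens (n := n))) s.
Proof.
move=> dt wT; elim: t gens dt => [|x l IHl r IHr] gens /=.
  move=> /andP[/eqP szT /allP hitT].
  set T := [seq j <- _ | _] in szT hitT.
  apply: (eq_weakly_regular _ (wT [set i : 'I_n | [:: (i : nat)] \in gens] _)); last first.
    exact: etrans (card_ord_filter n (fun j => [:: j] \in gens)) szT.
  move=> f; apply: eq_monomial_ideal => m; apply/exists_inP/hasP => [[j]|[g gg]].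
    rewrite inE => jg mj; exists [:: (j : nat)] => //=.
    by rewrite andbT -mnm_nth.
  have /hasP [j jg jT] := hitT g gg.
  have : j \in T := jT; rewrite mem_filter mem_iota => /andP[jgens /= ltj].
  move=> /allP /(_ j jg) mj; exists (Ordinal ltj); first by rewrite inE.
  by rewrite (mnm_nth 0%N).
move=> /and3P[ltx /IHl wl /IHr wr]; pose i := Ordinal ltx.
have iM := monomial_ideal_ideal k (@coveredD gens n).
apply: (weakly_regular_split (x := 'X_i)) => //.
  apply: eq_weakly_regular wl => f; rewrite colon_monomial_ideal.
  apply: eq_monomial_ideal => m; set e := (m + _)%MM.
  have eE (j : 'I_n) : e j = (m j + (i == j))%N by rewrite mnmDE mnm1E.
  clearbody e; rewrite /covered has_map; apply: eq_has => g /=.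
  rewrite all_filter; apply: eq_all => j /=.
  have [ltj|gej] := ltnP j n.
    have nthE (m' : 'X_{1..n}) : nth 0%N m' j = m' (Ordinal ltj) by rewrite (mnm_nth 0%N).
    rewrite !nthE eE -(inj_eq val_inj) /=.
    by rewrite eq_sym; case: eqP => /=; rewrite ?addn1 ?addn0.
  rewrite !nth_default ?size_tuple //; case: eqP => // E.
  by move: gej; rewrite E leqNgt ltx.
apply: eq_weakly_regular wr => f; rewrite add_principal_monomial_ideal; last exact: coveredD.
apply: eq_monomial_ideal => m; rewrite /covered /= andbT.
by rewrite -(mnm_nth 0%N m i).
Qed.

Lemma decomposes_nonempty n c t gens g : decomposes n c t gens -> g \in gens -> g != [::].
Proof.
move=> dt gg; apply: contraTneq dt => E; rewrite {g}E in gg.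
elim: t gens gg => [|x l IHl r IHr] gens gg /=.
  by rewrite negb_and; apply/orP; right; apply/allPn; exists [::].
rewrite (negbTE (IHl _ _)) ?andbF //.
by apply/mapP; exists [::].
Qed.

(** At a split on x the path goes right if z x holds and left otherwise. With z the variables in a
    prime this yields a prime generated by c variables below it; with z the variables absent from a
    monomial, it yields a facet containing the support. *)
Lemma decomposes_hitting n c t gens (z : nat -> Prop) :
  decomposes n c t gens -> (forall g, g \in gens -> exists2 j, j \in g & z j) ->
  exists T : {set 'I_n}, [/\ #|T| = c, forall j, j \in T -> z j &
    forall g, g \in gens -> exists2 j, j \in T & (j : nat) \in g].
Proof.
elim: t gens => [|x l IHl r IHr] gens /=.
  move=> /andP[/eqP szT /allP hitT] zg.
  exists [set i : 'I_n | [:: (i : nat)] \in gens]; split.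
    - exact: etrans (card_ord_filter n (fun j => [:: j] \in gens)) szT.
    by move=> j; rewrite inE => /zg [i]; rewrite inE => /eqP ->.
  move=> g gg; have /hasP [j jg jT] := hitT g gg.
  have : j \in [seq j <- iota 0 n | [:: j] \in gens] := jT.
  rewrite mem_filter mem_iota => /andP[jgens /= ltj].
  by exists (Ordinal ltj); rewrite ?inE.
move=> /and3P[ltx dl dr] zg; have [zx|nzx] := classic (z x).
  case: (IHr _ dr) => [g|T [cT Tz hit]].
    by rewrite inE => /predU1P[->|/zg //]; exists x; rewrite ?inE.
  by exists T; split=> // g gg; apply: hit; rewrite inE gg orbT.
case: (IHl _ dl) => [g /mapP [h hg ->]|T [cT Tz hit]].
  have [j jh zj] := zg h hg; exists j => //; rewrite mem_filter jh andbT.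
  by apply/eqP => E; apply: nzx; rewrite -E.
exists T; split=> // g gg; case: (hit [seq j <- g | j != x]); first exact: map_f.
by move=> j jT; rewrite mem_filter => /andP[_ jg]; exists j.
Qed.

Section Decomposable.
Variables (k : fieldType) (n c : nat) (t : split_tree) (gens : seq (seq nat)).
Hypothesis dt : decomposes n c t gens.
Local Notation A := {mpoly k[n]}.
Let I : A -> Prop := monomial_ideal (covered gens (n := n)).

Let I_ideal : is_ideal I.
Proof. exact: monomial_ideal_ideal (@coveredD gens n). Qed.

Lemma covered_sub_vars_prime (T : {set 'I_n}) :
  (forall g, g \in gens -> exists2 j, j \in T & (j : nat) \in g) ->
  sub_ideal I (vars_prime T).
Proof.
move=> hit f If m /If /hasP [g gg /allP mg]; have [j jT jg] := hit g gg.
by apply/exists_inP; exists j => //; rewrite (mnm_nth 0%N) mg.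
Qed.

Lemma decomposes_minimal_prime (P : A -> Prop) : prime_ideal P -> sub_ideal I P ->
  exists T : {set 'I_n}, [/\ #|T| = c, forall j, j \in T -> P 'X_j &
    sub_ideal I (vars_prime T)].
Proof.
move=> pP IP; pose z j := forall ltj : (j < n)%N, P 'X_(Ordinal ltj).
have [|T [cT Tz hit]] := @decomposes_hitting n c t gens z dt.
  move=> g gg; apply: NNPP => no.
  have ltg j : j \in g -> (j < n)%N.
    move=> jg; apply: contraT; rewrite -leqNgt => gej.
    by case: no; exists j => // ltj; move: gej; rewrite leqNgt ltj.
  have Ig : I 'X_[ [multinom ((i : nat) \in g : nat) | i < n] ].
    apply: monomial_idealX; apply/hasP; exists g => //; apply/allP => j jg.
    by rewrite -(mnm_nth 0%N _ (Ordinal (ltg j jg))) mnmE /= jg.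
  have [j Pj] := prime_monomial pP (IP _ Ig); rewrite mnmE eqb0 negbK => jg.
  by apply: no; exists (j : nat) => // ltj; congr P: Pj; congr 'X_(_); apply: val_inj.
exists T; split=> //; last exact: covered_sub_vars_prime.
move=> j jT; have := Tz j jT (ltn_ord j).
by congr P; congr 'X_(_); apply: val_inj.
Qed.

Lemma decomposes_exists : exists T : {set 'I_n},
  #|T| = c /\ forall g, g \in gens -> exists2 j, j \in T & (j : nat) \in g.
Proof.
have [g gg|T [cT _ hit]] := @decomposes_hitting n c t gens (fun=> True) dt.
  have := decomposes_nonempty dt gg; case: g {gg} => // j g _.
  by exists j; rewrite ?mem_head.
by exists T.
Qed.

Lemma decomposes_cohen_macaulay : cohen_macaulay I.
Proof.
have cTn (T : {set 'I_n}) : #|~: T| = (n - c)%N <-> #|T| = c.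
  have := cardsC T; rewrite card_ord.
  have [T0 [<- _]] := decomposes_exists; have := subset_leq_card (subsetT T0).
  by rewrite cardsT card_ord; lia.
apply: (@cohen_macaulay_criterion k n I (n - c) (enum [set F : {set 'I_n} | #|F| == (n - c)%N])).
- exact: I_ideal.
- by move=> F; rewrite mem_enum inE => /eqP ->.
- move=> m; case: (boolP (covered gens m)) => mg; [left|right].
    exact: monomial_idealX.
  have [g gg|T [cT Tz _]] := @decomposes_hitting n c t gens (fun j => nth 0%N m j = 0%N) dt.
    move: mg => /hasPn /(_ g gg) /allPn [j jg]; rewrite negbK => /eqP mj.
    by exists j.
  exists (~: T); first by rewrite mem_enum inE; apply/eqP/cTn.
  by move=> i; rewrite inE negbK => /Tz; rewrite -mnm_nth.
- move=> P pP IP; have [T [cT TP IT]] := decomposes_minimal_prime pP IP.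
  by exists T; split=> //; apply/cTn.
- move=> s ws; apply: decomposes_regular dt _ => T cT.
  by apply: ws; apply/cTn.
Qed.

Lemma decomposes_codim : has_codim I c.
Proof.
split.
  have [T [cT hit]] := decomposes_exists.
  exists (vars_prime T); rewrite -cT; split; first exact: vars_prime_prime.
    exact: covered_sub_vars_prime.
  exact: vars_prime_height.
move=> P m pP IP [_ hP]; have [T [<- TP _]] := decomposes_minimal_prime pP IP.
by apply: hP; apply: vars_chain.
Qed.

End Decomposable.

(** * Collapses *)

(* Sets of vertices are encoded by bit lists, on which the face relations can be
   evaluated. *)
Definition code (s : seq nat) : bitseq := mkseq (fun i => i \in s) 9.

Definition encode (F : {set vertex}) : bitseq := mkseq (fun i => inord i \in F) 9.

Definition decode (b : bitseq) : {set vertex} := [set u : vertex | nth false b u].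

Lemma nth_encode F (u : vertex) : nth false (encode F) u = (u \in F).
Proof. by rewrite nth_mkseq ?inord_val. Qed.

Lemma encodeK : cancel encode decode.
Proof. by move=> F; apply/setP => u; rewrite inE nth_encode. Qed.

Lemma decodeK b : size b = 9 -> encode (decode b) = b.
Proof.
move=> sb; apply: (@eq_from_nth _ false); first by rewrite size_mkseq.
move=> i; rewrite size_mkseq => lti.
by rewrite (nth_encode _ (Ordinal lti)) inE.
Qed.

Lemma encode_inj : injective encode.
Proof. exact: can_inj encodeK. Qed.

Lemma encode_vset s : encode (vset s) = code s.
Proof.
apply: (@eq_from_nth _ false); rewrite !size_mkseq // => i lti.
by rewrite (nth_encode _ (Ordinal lti)) inE nth_mkseq.
Qed.

Lemma vset0 : vset [::] = set0.
Proof. by apply/setP => u; rewrite !inE. Qed.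

Lemma vset1 (u : vertex) : vset [:: u : nat] = [set u].
Proof. by apply/setP => v; rewrite !inE. Qed.

Lemma vsetT : vset (iota 0 9) = setT.
Proof. by apply/setP => u; rewrite in_set in_setT mem_iota ltn_ord. Qed.

Definition edge_lists : seq (seq nat) :=
  [:: [:: 0; 1]; [:: 1; 2]; [:: 2; 3]; [:: 3; 4]; [:: 4; 5]; [:: 5; 6];
      [:: 6; 7]; [:: 7; 0]; [:: vc; 1]; [:: vc; 3]; [:: vc; 5]; [:: vc; 7];
      [:: 0; 2]; [:: 2; 4]; [:: 4; 6]; [:: 6; 0]]%N.

Definition polygon_lists : seq (seq nat) :=
  [:: [:: vc; 1; 2; 3]; [:: vc; 3; 4; 5]; [:: vc; 5; 6; 7]; [:: vc; 7; 0; 1];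
      [:: 0; 2; 4; 6]; [:: 0; 1; 2]; [:: 2; 3; 4]; [:: 4; 5; 6]; [:: 6; 7; 0]]%N.

Definition vertex_codes : seq bitseq := Eval vm_compute in [seq code [:: j] | j <- iota 0 9].
Definition edge_codes : seq bitseq := Eval vm_compute in map code edge_lists.
Definition polygon_codes : seq bitseq := Eval vm_compute in map code polygon_lists.

Definition face_codes (i : nat) : seq bitseq :=
  match i with
  | 0 => [:: nseq 9 false]
  | 1 => vertex_codes
  | 2 => edge_codes
  | 3 => polygon_codes
  | 4 => [:: nseq 9 true]
  | _ => [::]
  end%N.

Lemma mem_map_vset F (l : seq (seq nat)) :
  (F \in map vset l) = (encode F \in map code l).
Proof.
rewrite -(mem_map encode_inj) -map_comp; congr (_ \in _).
by apply: eq_map => s /=; apply: encode_vset.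
Qed.

Lemma facesE i F : (F \in faces i) = (encode F \in face_codes i).
Proof.
case: i => [|[|[|[|[|i]]]]].
- by rewrite !inE -vset0 -(inj_eq encode_inj) encode_vset.
- rewrite -[face_codes 1]/[seq code [:: j] | j <- iota 0 9].
  apply/imsetP/mapP => [[u _ ->]|[j]].
    by exists (u : nat); [rewrite mem_iota ltn_ord|rewrite -vset1 encode_vset].
  rewrite mem_iota /= add0n => ltj; rewrite -encode_vset => /encode_inj ->.
  by exists (Ordinal ltj); last rewrite -vset1.
- by rewrite inE mem_map_vset.
- by rewrite inE mem_map_vset.
- by rewrite !inE -vsetT -(inj_eq encode_inj) encode_vset.
- by rewrite !inE.
Qed.

Definition code_sub (a b : bitseq) : bool :=
  all (fun i => nth false a i ==> nth false b i) (iota 0 9).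

Lemma code_subE (F G : {set vertex}) : (F \subset G) = code_sub (encode F) (encode G).
Proof.
apply/subsetP/allP => [FG i|FG u].
  rewrite mem_iota /= add0n => lti; apply/implyP.
  by rewrite !(nth_encode _ (Ordinal lti)); apply: FG.
have uI : (u : nat) \in iota 0 9 by rewrite mem_iota ltn_ord.
by have /implyP := FG u uI; rewrite !nth_encode.
Qed.

Definition facet_code (a b : bitseq) : bool :=
  has (fun i => [&& a \in face_codes i, b \in face_codes i.+1 & code_sub a b]) (iota 0 4).

Lemma is_facetE G F : is_facet G F = facet_code (encode G) (encode F).
Proof.
apply/existsP/hasP => [[i]|[i]].
  by rewrite !facesE code_subE => H; exists (i : nat); first rewrite mem_iota ltn_ord.
rewrite mem_iota => /andP[_ lti] H; exists (Ordinal lti).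
by rewrite !facesE code_subE; apply: H.
Qed.

Definition all_codes : seq bitseq := flatten (map face_codes (iota 0 5)).

Lemma face_codes_all i b : b \in face_codes i -> b \in all_codes.
Proof.
move=> bi; apply/flatten_mapP; exists i => //; rewrite mem_iota /= add0n.
by case: i bi => [|[|[|[|[|i]]]]].
Qed.

Lemma faces_disjoint i j F : F \in faces i -> F \in faces j -> i = j.
Proof.
have dis : all (fun i => all (fun j => all (fun b => (b \in face_codes j) ==> (i == j))
    (face_codes i)) (iota 0 5)) (iota 0 5) by vm_compute.
rewrite !facesE => bi bj.
have lt5 l : encode F \in face_codes l -> l \in iota 0 5.
  by rewrite mem_iota /= add0n; case: l => [|[|[|[|[|l]]]]].
have /allP /(_ j (lt5 _ bj)) /allP /(_ _ bi) := allP dis i (lt5 _ bi).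
by rewrite bj => /eqP.
Qed.

Lemma is_facet_sub (G F : {set vertex}) : is_facet G F -> G \subset F.
Proof. by case/existsP => i /and3P[]. Qed.

Lemma is_facet_faces i G F : is_facet G F -> F \in faces i.+1 -> G \in faces i.
Proof.
case/existsP => j /and3P[Gj Fj _] Fi.
by have [->] := faces_disjoint Fi Fj.
Qed.

Lemma is_facet_cofaces i G F : is_facet G F -> G \in faces i -> F \in faces i.+1.
Proof.
case/existsP => j /and3P[Gj Fj _] Gi.
by have -> := faces_disjoint Gi Gj.
Qed.

(** * Chains over k and elementary collapses *)

Section Chains.
Variables (k : fieldType) (sgn : {set vertex} -> {set vertex} -> int).
Hypothesis sgn_incidence : incidence_function sgn.
Implicit Types (c w : {set vertex} -> k) (F G H : {set vertex}).

(** Chains are functions on all vertex sets, in all dimensions at once; the incidence function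
    vanishes off codimension one pairs, so no grading has to be carried along. *)
Definition boundary c G : k := \sum_F (sgn G F)%:~R * c F.

Lemma sgn_facet G F : (sgn G F)%:~R != 0 :> k -> is_facet G F.
Proof.
case: sgn_incidence => _ s0 _ _; apply: contraR => /s0 ->.
by rewrite eqxx.
Qed.

Lemma sgn_sqr G F : is_facet G F -> (sgn G F)%:~R * (sgn G F)%:~R = 1 :> k.
Proof.
case: sgn_incidence => s1 _ _ _ /s1 [->|->]; first by rewrite mulr1.
by rewrite -intrM mulrNN mulr1.
Qed.

Lemma boundaryB c w G : boundary (fun F => c F - w F) G = boundary c G - boundary w G.
Proof. by rewrite /boundary -sumrB; apply: eq_bigr => F _; rewrite mulrBr. Qed.

Lemma boundaryD c w G : boundary (fun F => c F + w F) G = boundary c G + boundary w G.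
Proof. by rewrite /boundary -big_split; apply: eq_bigr => F _; rewrite mulrDr. Qed.

Lemma eq_boundary c w G : c =1 w -> boundary c G = boundary w G.
Proof. by move=> cw; apply: eq_bigr => F _; rewrite cw. Qed.

Lemma boundary0 G : boundary (fun=> 0) G = 0.
Proof. by apply: big1 => F _; rewrite mulr0. Qed.

Lemma boundary_boundary c H : boundary (boundary c) H = 0.
Proof.
transitivity (\sum_F (\sum_G sgn H G * sgn G F)%:~R * c F).
  rewrite /boundary; under eq_bigr => G _ do rewrite mulr_sumr.
  rewrite exchange_big /=; apply: eq_bigr => F _.
  rewrite rmorph_sum /= mulr_suml; apply: eq_bigr => G _.
  by rewrite mulrA rmorphM.
apply: big1 => F _.
suff -> : \sum_G sgn H G * sgn G F = 0 by rewrite mul0r.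
case: sgn_incidence => _ s0 _ s2.
have -> : \sum_G sgn H G * sgn G F =
    \sum_(G | is_facet H G && is_facet G F) sgn H G * sgn G F.
  rewrite [LHS](bigID (fun G => is_facet H G && is_facet G F)) /=.
  rewrite [X in _ + X]big1 ?addr0 // => G; rewrite negb_and.
  by case/orP => /s0 ->; rewrite ?mul0r ?mulr0.
case: (pickP (fun G => is_facet H G && is_facet G F)) => [G /andP[HG GF]|none].
  have /existsP [i /and3P[Hi Gi _]] := HG.
  apply: (s2 i); rewrite ?Hi ?(is_facet_cofaces GF Gi) //.
  exact: subset_trans (is_facet_sub HG) (is_facet_sub GF).
by rewrite big_pred0.
Qed.

Definition supported (K : pred {set vertex}) c : Prop := forall F, c F != 0 -> K F.

(** The empty face counts, so this is vanishing of reduced homology: the void family is acyclic, the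
    family of the empty face alone is not. *)
Definition acyclic (K : pred {set vertex}) : Prop :=
  forall c, supported K c -> (forall G, boundary c G = 0) ->
  exists2 w, supported K w & forall G, boundary w G = c G.

Lemma eq_acyclic K L : K =1 L -> acyclic K -> acyclic L.
Proof.
move=> KL ac c Lc dc; have [F|w Kw dw] := ac c _ dc; first by rewrite KL; apply: Lc.
by exists w => // F /Kw; rewrite KL.
Qed.

Lemma acyclic0 : acyclic pred0.
Proof.
move=> c c0 _; exists c => // G; transitivity (0 : k).
  rewrite -(boundary0 G); apply: eq_boundary => F.
  by apply/eqP; apply: contraT => /c0.
by apply/esym/eqP; apply: contraT => /c0.
Qed.

(** The boundary of a cycle has at the free face G, up to sign, the coefficient of the cycle at F,
    which therefore vanishes. Subtracting a multiple of the boundary of F clears the coefficient at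
    G as well. *)
Lemma acyclic_collapse (K : pred {set vertex}) G F : K F -> is_facet G F ->
  (forall H, K H -> is_facet G H -> H = F) -> (forall H, is_facet H F -> K H) ->
  acyclic (fun H => [&& K H, H != G & H != F]) -> acyclic K.
Proof.
move=> KF GF Gfree Fclosed ac c Kc dc.
have nFF : ~~ is_facet F F.
  apply/negP => FF; have /existsP [i /and3P[Fi Fi1 _]] := FF.
  by have /eqP := faces_disjoint Fi Fi1; rewrite eqn_leq ltnn andbF.
have cF : c F = 0.
  have := dc G; rewrite /boundary (bigD1 F) //= big1 ?addr0 => [E|H HF].
    by rewrite -[c F]mul1r -(sgn_sqr GF) -mulrA E mulr0.
  apply/eqP; rewrite mulf_eq0 -[_ || _]negbK negb_or; apply/negP => /andP[/sgn_facet GH /Kc HK].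
  by rewrite (Gfree H HK GH) eqxx in HF.
pose w0 H : k := if H == F then (sgn G F)%:~R * c G else 0.
have dw0 H : boundary w0 H = (sgn H F)%:~R * ((sgn G F)%:~R * c G).
  rewrite /boundary (bigD1 F) //= big1 ?addr0 => [|X /negbTE XF]; rewrite /w0.
    by rewrite eqxx.
  by rewrite XF mulr0.
have [|H|w Kw dw] := ac (fun H => c H - boundary w0 H).
- move=> H; rewrite dw0 => nz.
  have -> : H != G.
    by apply: contraNneq nz => ->; rewrite mulrA (sgn_sqr GF) mul1r subrr.
  have -> : H != F.
    apply: contraNneq nz => ->; rewrite cF sub0r oppr_eq0 !mulf_eq0.
    by apply/orP; left; apply: contraNT nFF => /sgn_facet.
  rewrite !andbT; have [cH|/Kc //] := eqVneq (c H) 0.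
  by move: nz; rewrite cH sub0r oppr_eq0 mulf_eq0 negb_or => /andP[/sgn_facet /Fclosed].
- by rewrite boundaryB dc boundary_boundary subr0.
exists (fun H => w H + w0 H) => [H|H]; last by rewrite boundaryD dw subrK.
rewrite /w0; case: (H =P F) => [->//|_].
by rewrite addr0 => /Kw /and3P[].
Qed.

End Chains.

(** The 36 = 1 + 9 + 16 + 9 + 1 faces, from the empty one up to P, are numbered by their position in
    the list of codes. The two tables hold the facet relation upwards and downwards, so that
    collapses are checked on numbers. *)
Definition cofacets : seq (seq nat) := Eval vm_compute in
  [seq [seq j <- iota 0 36 | facet_code (nth [::] all_codes i) (nth [::] all_codes j)]
  | i <- iota 0 36].

Definition facets : seq (seq nat) := Eval vm_compute in
  [seq [seq j <- iota 0 36 | facet_code (nth [::] all_codes j) (nth [::] all_codes i)]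
  | i <- iota 0 36].

Definition codes : seq bitseq := Eval vm_compute in all_codes.

Definition index_face (F : {set vertex}) : nat := index (encode F) codes.

Lemma index_face_lt F : encode F \in codes -> (index_face F < 36)%N.
Proof. by move=> Fc; exact: (etrans (index_mem _ _) Fc). Qed.

Lemma facet_codes_index : allrel (fun a b => facet_code a b ==>
    (index b codes \in nth [::] cofacets (index a codes)) &&
    (index a codes \in nth [::] facets (index b codes))) codes codes.
Proof. by vm_compute. Qed.

Opaque codes cofacets facets.

Lemma facet_index G F : is_facet G F ->
  [/\ (index_face G < 36)%N, (index_face F < 36)%N,
      index_face F \in nth [::] cofacets (index_face G) &
      index_face G \in nth [::] facets (index_face F)].
Proof.
move=> GF; have /existsP [i /and3P[Gi Fi _]] := GF; rewrite !facesE in Gi Fi.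
have {}Gi : encode G \in codes := face_codes_all Gi.
have {}Fi : encode F \in codes := face_codes_all Fi.
have := implyP (allrelP facet_codes_index _ _ Gi Fi).
rewrite -is_facetE => check; case/andP: (check GF) => FG GF'.
by split; [exact: index_face_lt|exact: index_face_lt|exact: FG|exact: GF'].
Qed.

Lemma index_facet i j : j \in nth [::] cofacets i ->
  [/\ (i < 36)%N, (j < 36)%N &
      is_facet (decode (nth [::] codes i)) (decode (nth [::] codes j))].
Proof.
have check : all (fun i => all (fun j =>
    [&& (j < 36)%N, facet_code (nth [::] codes i) (nth [::] codes j),
        size (nth [::] codes i) == 9 & size (nth [::] codes j) == 9])
    (nth [::] cofacets i)) (iota 0 36) by vm_compute.
move=> ij; have lti : (i < 36)%N.
  by rewrite ltnNge; apply: contraTN ij => gei; rewrite nth_default.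
have i36 : i \in iota 0 36 by rewrite mem_iota.
have /allP/(_ _ ij)/and4P[ltj ? /eqP si /eqP sj] := allP check i i36.
by rewrite is_facetE !decodeK.
Qed.

(* sets of faces as bit masks along the list codes *)
Definition in_mask (m : bitseq) (F : {set vertex}) : bool := nth false m (index_face F).

Fixpoint collapses (m : bitseq) (ps : seq (nat * nat)) : bool :=
  if ps is (g, f) :: ps' then
    let cof := nth [::] cofacets g in
    [&& nth false m f, f \in cof,
        all (fun j => nth false m j ==> (j == f)) cof,
        all (fun j => nth false m j) (nth [::] facets f) &
        collapses (set_nth false (set_nth false m g false) f false) ps']
  else all negb m.

(** Greedy search, validated afterwards by [collapses]. Each pair removes two of the 36 faces, so
    fuel 18 is enough. If no face is free, [find] returns 36, where the table yields the default
    [::], and the search stops. *)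
Fixpoint find_collapse (fuel : nat) (m : bitseq) : seq (nat * nat) :=
  if fuel is fuel'.+1 then
    let alive g := [seq j <- nth [::] cofacets g | nth false m j] in
    let g := find (fun g => size (alive g) == 1) (iota 0 36) in
    if alive g is f :: _ then
      (g, f) :: find_collapse fuel' (set_nth false (set_nth false m g false) f false)
    else [::]
  else [::].

Lemma index_face_decode i F : (i < 36)%N ->
  (index_face F == i) = (F == decode (nth [::] codes i)).
Proof.
have check : all (fun i => (size (nth [::] codes i) == 9) &&
    (index (nth [::] codes i) codes == i)) (iota 0 36) by vm_compute.
move=> lti; have i36 : i \in iota 0 36 by rewrite mem_iota.
have /andP[/eqP si /eqP ii] := allP check i i36.
apply/eqP/eqP => [E|->]; last by rewrite /index_face decodeK.
have Fc : encode F \in codes by rewrite -index_mem -[index _ _]/(index_face F) E.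
by rewrite -E /index_face nth_index // encodeK.
Qed.

Lemma collapses_acyclic (k : fieldType) sgn m ps : incidence_function sgn ->
  collapses m ps -> @acyclic k sgn (in_mask m).
Proof.
move=> sgnI; elim: ps m => [|[g f] ps IH] m /=.
  move=> /allP m0; apply: (eq_acyclic _ (@acyclic0 k sgn)) => F.
  rewrite /in_mask; apply/esym/negbTE.
  have [ltm|gem] := ltnP (index_face F) (size m); last by rewrite nth_default.
  exact/m0/mem_nth.
case/and5P => mf fg /allP gfree /allP fclosed /IH ac.
have [ltg ltf GF] := index_facet fg; set G := decode _ in GF; set F := decode _ in GF.
have Eg : index_face G = g by apply/eqP; rewrite index_face_decode.
have Ef : index_face F = f by apply/eqP; rewrite index_face_decode.
apply: (acyclic_collapse sgnI (G := G) (F := F)) => //.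
- by rewrite /in_mask Ef.
- move=> H mH GH; have [_ _ Hg _] := facet_index GH.
  rewrite Eg in Hg; have := gfree _ Hg.
  by rewrite -/(in_mask m H) mH /= index_face_decode // => /eqP.
- move=> H HF; have [_ _ _] := facet_index HF.
  by rewrite Ef => /fclosed.
apply: eq_acyclic ac => H; rewrite /in_mask !nth_set_nth /= nth_set_nth /=.
by rewrite !index_face_decode // -/G -/F; do 2 case: eqP => //=; rewrite ?andbF ?andbT.
Qed.

(** * Strands of the cellular complex *)

Section Labels.
Variables (r : nat) (a : labelling r).
Implicit Types (F G : {set vertex}) (n : 'X_{1..r}).

Lemma face_label_le F n :
  (face_label a F <= n)%MM = [forall u in F, (a u <= n)%MM].
Proof.
have seqE (s : seq vertex) : ((\big[@mlcm r/0%MM]_(u <- s | u \in F) a u) <= n)%MM =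
    all (fun u => (u \in F) ==> (a u <= n)%MM) s.
  elim: s => [|u s IH]; first by rewrite big_nil; apply/mnm_lepP => p; rewrite mnm0E.
  by rewrite big_cons /=; case: (u \in F); rewrite ?lem_mlcm ?IH.
rewrite /face_label seqE; apply/allP/forall_inP => [H u uF|H u _].
  by have /implyP := H u (mem_index_enum u); apply.
by apply/implyP/H.
Qed.

Lemma label_le_face u F : u \in F -> (a u <= face_label a F)%MM.
Proof.
move=> uF; have := face_label_le F (face_label a F).
by rewrite lepm_refl => /esym/forall_inP; apply.
Qed.

Lemma face_labelS F G : G \subset F -> (face_label a G <= face_label a F)%MM.
Proof.
move=> /subsetP GF; rewrite face_label_le; apply/forall_inP => u /GF.
exact: label_le_face.
Qed.

Lemma face_label_vertex u : face_label a [set u] = a u.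
Proof.
apply/mnmP => p; apply/eqP; rewrite eqn_leq.
have /mnm_lepP -> : (a u <= face_label a [set u])%MM by apply: label_le_face; rewrite inE.
rewrite andbT; have /mnm_lepP -> // : (face_label a [set u] <= a u)%MM.
by rewrite face_label_le; apply/forall_inP => v /set1P ->; apply: lepm_refl.
Qed.

Lemma face_label0 : face_label a set0 = 0%MM.
Proof.
apply/mnmP => p; apply/eqP; rewrite mnm0E -leqn0.
have /mnm_lepP/(_ p) : (face_label a set0 <= 0)%MM; last by rewrite mnm0E.
by rewrite face_label_le; apply/forall_inP => v; rewrite inE.
Qed.

End Labels.

Section Strands.
Variables (k : fieldType) (sgn : {set vertex} -> {set vertex} -> int).
Hypothesis sgn_incidence : incidence_function sgn.
Variables (r : nat) (a : labelling r).
Implicit Types (F G : {set vertex}) (n : 'X_{1..r}) (c : {set vertex} -> k).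
Local Notation lab := (face_label a).
Local Notation chain i := {ffun cell i -> {mpoly k[r]}}.
Local Notation bd := (boundary sgn).

(* the component of degree n of a chain, with the generator e_F in the degree of
   its label *)
Definition strand i n (z : chain i) F : k :=
  if (insub F : option {G | G \in faces i}) is Some G then
    if (lab F <= n)%MM then (z G)@_(n - lab F) else 0
  else 0.

Lemma strand_val i n (z : chain i) (F : cell i) :
  strand n z (val F) = if (lab (val F) <= n)%MM then (z F)@_(n - lab (val F)) else 0.
Proof. by rewrite /strand valK. Qed.

Lemma strand_support i n (z : chain i) F :
  strand n z F != 0 -> F \in faces i /\ (lab F <= n)%MM.
Proof.
rewrite /strand; case: insubP => [G Fi _|]; last by rewrite eqxx.
by case: ifP; rewrite ?eqxx.
Qed.

Lemma strand_inj i (z w : chain i) :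
  (forall n F, strand n z F = strand n w F) -> z = w.
Proof.
move=> zw; apply/ffunP => F; apply/mpolyP => m.
have := zw (m + lab (val F))%MM (val F).
by rewrite !strand_val lem_addl addmK.
Qed.

Lemma mcoeffXM (m e : 'X_{1..r}) (p : {mpoly k[r]}) :
  ('X_[m] * p)@_e = if (m <= e)%MM then p@_(e - m) else 0.
Proof.
rewrite mulrC; case: ifP => [me|nme]; first by rewrite -{1}(submK me) addmC mcoeffMX.
apply/eqP; rewrite mcoeff_eq0 (perm_mem (msuppMX p m)); apply: contraFN nme.
by case/mapP => d _ ->; apply: lem_addr.
Qed.

(** In a fixed degree the monomials m_F / m_G act as 1, so the differential becomes the boundary
    operator on the faces whose label divides that degree. *)
Lemma strand_boundary i n (z : chain i.+1) G :
  bd (strand n z) G = strand n (cell_diff sgn a z) G.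
Proof.
case: (boolP ((G \in faces i) && (lab G <= n)%MM)) => [/andP[Gi Gn]|nG]; last first.
  transitivity (0 : k); last first.
    by apply/esym/eqP; apply: contraNT nG => /strand_support [-> ->].
  apply: big1 => F _; apply/eqP; apply: contraNT nG; rewrite mulf_eq0 negb_or.
  case/andP=> /(sgn_facet sgn_incidence) GF /strand_support [Fi Fn].
  rewrite (is_facet_faces GF Fi); apply: lepm_trans Fn.
  exact: face_labelS (is_facet_sub GF).
have [G' valG] : exists G' : cell i, val G' = G by exists (Sub G Gi); rewrite SubK.
rewrite -valG in Gn *; rewrite strand_val Gn ffunE raddf_sum /=.
transitivity (\sum_(F in faces i.+1 | is_facet (val G') F)
    (sgn (val G') F)%:~R * strand n z F).
  rewrite /boundary [LHS](bigID (fun F => (F \in faces i.+1) && is_facet (val G') F)) /=.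
  rewrite [X in _ + X]big1 ?addr0 // => F; rewrite negb_and => /orP nF.
  apply/eqP; rewrite mulf_eq0; case: nF => nF; apply/orP; [right|left].
    by apply: contraNT nF => /strand_support [].
  by apply: contraNT nF => /(sgn_facet sgn_incidence).
rewrite big_sub_cond; apply: eq_bigr => F GF.
have le := face_labelS a (is_facet_sub GF).
rewrite -[X in X * _ * _](rmorph_int (@mpolyC r k)) -mulrA mcoeffCM; congr (_ * _).
rewrite strand_val mcoeffXM.
have -> : (lab (val F) - lab (val G') <= n - lab (val G'))%MM = (lab (val F) <= n)%MM.
  apply/mnm_lepP/mnm_lepP => H p; have {H} := H p;
  have := mnm_lepP le p; have := mnm_lepP Gn p; rewrite !mnmBE;
  by move: (n p) (lab (val F) p) (lab (val G') p) => x y z'; lia.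
by case: ifP => // _; rewrite submDA addmC submK.
Qed.

Definition of_strands i (N : seq 'X_{1..r}) (W : 'X_{1..r} -> {set vertex} -> k) : chain i :=
  [ffun F => \sum_(n <- N) W n (val F) *: 'X_[n - lab (val F)]].

Lemma strand_of_strands i N W n F : uniq N ->
  (forall n F, W n F != 0 -> F \in faces i /\ (lab F <= n)%MM) ->
  strand n (of_strands i N W) F = if n \in N then W n F else 0.
Proof.
move=> uN supW.
case: (boolP ((F \in faces i) && (lab F <= n)%MM)) => [/andP[Fi Fn]|nF]; last first.
  transitivity (0 : k).
    by apply/eqP; apply: contraNT nF => /strand_support [-> ->].
  apply/esym/eqP; case: ifP => // _; apply: contraNT nF.
  by move=> /supW [-> ->].
have [F' valF] : exists F' : cell i, val F' = F by exists (Sub F Fi); rewrite SubK.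
rewrite -valF in Fn *; rewrite strand_val Fn ffunE raddf_sum /=.
have other n' : n' != n -> (W n' (val F') *: 'X_[k, n' - lab (val F')])@_(n - lab (val F')) = 0.
  move=> nn; rewrite mcoeffZ mcoeffX; apply/eqP; rewrite mulf_eq0.
  case: (eqVneq (W n' (val F')) 0) => //= /supW [_ Fn'].
  have [E|_] := eqVneq (n' - lab (val F'))%MM (n - lab (val F'))%MM; last by rewrite eqxx.
  by case/eqP: nn; rewrite -(submK Fn') E submK.
case: ifP => nN.
  rewrite (bigD1_seq n) //= big1 ?addr0 => [|n' nn]; last exact: other.
  by rewrite mcoeffZ mcoeffX eqxx mulr1.
rewrite big_seq big1 // => n' n'N; apply: other.
by apply: contraFneq nN => <-.
Qed.

Lemma cell_diff_diff i (z : chain i.+2) : cell_diff sgn a (cell_diff sgn a z) = 0.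
Proof.
apply: strand_inj => n F; rewrite -strand_boundary.
rewrite (eq_boundary _ _ (fun G => esym (strand_boundary n z G))).
rewrite boundary_boundary // /strand; case: insubP => // G _ _.
by case: ifP; rewrite // ffunE mcoeff0.
Qed.

Definition strand_exact i n : Prop :=
  forall c, (forall F, c F != 0 -> F \in faces i.+1 /\ (lab F <= n)%MM) ->
  (forall G, bd c G = 0) ->
  exists w, (forall F, w F != 0 -> F \in faces i.+2 /\ (lab F <= n)%MM) /\
    forall G, bd w G = c G.

Lemma strand_exact_of_acyclic i n :
  @acyclic k sgn (fun F => (encode F \in codes) && (lab F <= n)%MM) ->
  strand_exact i n.
Proof.
move=> ac c supc dc; have [F /supc [Fi Fn]|w Kw dw] := ac c _ dc.
  by rewrite Fn andbT; apply: (@face_codes_all i.+1); rewrite -facesE.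
exists (fun F => if F \in faces i.+2 then w F else 0); split=> [F|G].
  by case: ifP; rewrite ?eqxx // => Fi /Kw /andP[].
case: (boolP (G \in faces i.+1)) => Gi.
  rewrite -dw; apply: eq_bigr => F _; case: ifP => // /negbT Fi.
  rewrite mulr0; apply/esym/eqP; rewrite mulf_eq0; apply/orP; left.
  apply: contraNT Fi => /(sgn_facet sgn_incidence) GF.
  exact: is_facet_cofaces GF Gi.
transitivity (0 : k); last first.
  by apply/esym/eqP; apply: contraNT Gi => /supc [].
apply: big1 => F _; case: ifP => Fi; last by rewrite mulr0.
apply/eqP; rewrite mulf_eq0; apply/orP; left.
apply: contraNT Gi => /(sgn_facet sgn_incidence) GF.
exact: is_facet_faces GF Fi.
Qed.

(** This strand consists of the empty face, which carries its only homology, at index 0; exactness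
    is asked from index 1 on. *)
Lemma strand_exact_empty i n : (forall u, ~~ (a u <= n)%MM) -> strand_exact i n.
Proof.
move=> an c supc _; exists (fun=> 0); split=> [F|G]; first by rewrite eqxx.
rewrite boundary0; apply/esym/eqP; apply: contraT => /supc [Gi Gn].
case: (set_0Vmem G) => [G0|[u uG]].
  have E0 : G \in faces 0 by rewrite G0 inE.
  by have := faces_disjoint E0 Gi.
case/negP: (an u); apply: lepm_trans Gn; exact: label_le_face.
Qed.

Lemma exact_of_strands i (z : chain i.+1) : (forall n, strand_exact i n) ->
  cell_diff sgn a z = 0 <-> exists w, z = cell_diff sgn a w.
Proof.
move=> ex; split=> [dz|[w ->]]; last exact: cell_diff_diff.
have dstrand n G : bd (strand n z) G = 0.
  rewrite strand_boundary dz /strand; case: insubP => // F _ _.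
  by case: ifP; rewrite // ffunE mcoeff0.
pose Q n (w : {set vertex} -> k) := (forall F, w F != 0 -> F \in faces i.+2 /\ (lab F <= n)%MM) /\
    forall G, bd w G = strand n z G.
(* A preimage is chosen in every degree. Only the finitely many degrees in N occur in z, so these
   choices assemble into a chain with polynomial coordinates. *)
pose W n := epsilon (inhabits (fun=> 0)) (Q n).
have QW n : Q n (W n).
  apply: epsilon_spec; apply: (ex n); last exact: dstrand.
  exact: strand_support.
pose N := undup (flatten [seq [seq (m + lab (val F))%MM | m <- msupp (z F)] | F : cell i.+1 <- enum (cell i.+1)]).
have uN : uniq N by apply: undup_uniq.
exists (of_strands i.+2 N W); apply: strand_inj => n F; rewrite -strand_boundary.
have sW m G : W m G != 0 -> G \in faces i.+2 /\ (lab G <= m)%MM by case: (QW m) => + _; apply.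
rewrite (eq_boundary _ _ (fun G => strand_of_strands n G uN sW)).
case: (boolP (n \in N)) => nN; first by have [_ ->] := QW n.
rewrite boundary0; apply: contraNeq nN => zF.
have [Fi Fn] := strand_support zF.
have [F' valF] : exists F' : cell i.+1, val F' = F by exists (Sub F Fi); rewrite SubK.
rewrite -valF in Fn zF; move: zF; rewrite strand_val Fn => zF.
rewrite mem_undup; apply/flatten_mapP; exists F'; first by rewrite mem_enum.
by apply/mapP; exists (n - lab (val F'))%MM; rewrite ?mcoeff_msupp ?submK.
Qed.

Lemma strands_of_exact i n :
  (forall z : chain i.+1, cell_diff sgn a z = 0 -> exists w, z = cell_diff sgn a w) ->
  strand_exact i n.
Proof.
move=> ex c supc dc.
pose z := of_strands i.+1 [:: n] (fun n' F => if n' == n then c F else 0).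
have sz m F : strand m z F = if m == n then c F else 0.
  rewrite strand_of_strands // ?inE => [|m' G]; first by case: (m == n).
  by case: (m' =P n) => [->|]; rewrite ?eqxx // => /supc.
have [|w zw] := ex z.
  apply: strand_inj => m G; rewrite -strand_boundary (eq_boundary _ _ (sz m)).
  transitivity (0 : k); first by case: (m == n); [apply: dc|apply: boundary0].
  by rewrite /strand; case: insubP => // F _ _; case: ifP; rewrite // ffunE mcoeff0.
exists (strand n w); split; first exact: strand_support.
by move=> G; rewrite strand_boundary -zw sz eqxx.
Qed.

Lemma cell_diff_vertices (z0 : chain 0) :
  (exists z, z0 = cell_diff sgn a z) <-> (forall G : cell 0, label_ideal a (z0 G)).
Proof.
have val0 (G : cell 0) : val G = set0 by apply/set1P/(valP G).
have facet0 u : is_facet set0 [set u].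
  apply/existsP; exists ord0; rewrite inE eqxx sub0set andbT /=.
  by apply/imsetP; exists u.
have diffE z (G : cell 0) : cell_diff sgn a z G =
    \sum_(F : cell 1) 'X_[k, lab (val F)] * z F.
  rewrite ffunE val0; apply: eq_big => F; have /imsetP [u _ ->] := valP F.
    by rewrite facet0.
  move=> _; case: sgn_incidence => _ _ s1 _.
  rewrite s1 mul1r face_label0; congr ('X_[_] * _).
  by apply/mnmP => p; rewrite mnmBE mnm0E subn0.
have vert u : [set u] \in faces 1 by apply/imsetP; exists u.
pose vx u : cell 1 := Sub [set u] (vert u).
have bij : bijective vx.
  pose g (F : cell 1) := odflt ord0 [pick u in val F].
  have gK (F : cell 1) : vx (g F) = F.
    apply/val_inj; rewrite SubK /g; have /imsetP [u _ E] := valP F.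
    rewrite E; case: pickP => [v /set1P -> //|/(_ u)].
    by rewrite inE eqxx.
  exists g => // u; apply: set1_inj.
  by have := congr1 val (gK (vx u)); rewrite !SubK.
split=> [[z ->] G|H].
  rewrite diffE (reindex vx) /=; last exact: onW_bij.
  exists (fun u => z (vx u)); apply: eq_bigr => u _.
  by rewrite mulrC face_label_vertex.
have E0 : set0 \in faces 0 by rewrite inE.
have [b zb] := H (Sub set0 E0).
have [g gK _] := bij.
exists [ffun F => b (g F)]; apply/ffunP => G.
have -> : G = Sub set0 E0 by apply/val_inj; rewrite SubK val0.
rewrite diffE zb (reindex vx) /=; last exact: onW_bij.
by apply: eq_bigr => u _; rewrite ffunE gK mulrC face_label_vertex.
Qed.

End Strands.

(** * The labelling of the family *)

Definition family_lists : seq (seq nat) :=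
  [:: [:: 0; 1; 2]; [:: 2; 3; 4]; [:: 4; 5; 6]; [:: 6; 7; 0]; [:: vc; 1; 3];
      [:: vc; 3; 5]; [:: vc; 5; 7]; [:: vc; 7; 1]; [:: 1; 2; 3]; [:: 3; 4; 5]]%N.

Definition in_family (u p : nat) : bool := u \in nth [::] family_lists p.

Definition family : 10.-tuple {set vertex} :=
  [tuple vset [:: 0; 1; 2]; vset [:: 2; 3; 4]; vset [:: 4; 5; 6];
         vset [:: 6; 7; 0]; vset [:: vc; 1; 3]; vset [:: vc; 3; 5];
         vset [:: vc; 5; 7]; vset [:: vc; 7; 1]; vset [:: 1; 2; 3];
         vset [:: 3; 4; 5]]%N.

Definition family_gens : seq (seq nat) :=
  [seq [seq p <- iota 0 10 | in_family u p] | u <- iota 0 9].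

(** The numbers are positions in [family_lists]; the tree is mere data, validated by evaluation in
    the next lemma. *)
Definition family_tree : split_tree :=
  let L := Leaf in let N := Split in
  N 0 (N 1 (N 2 (N 4 (N 5 (N 6 L L) L) L) (N 4 (N 5 (N 6 L L) L) L))
           (N 4 (N 5 (N 6 (N 2 L L) (N 7 L L)) (N 7 L L))
                (N 2 (N 5 (N 6 L L) L) L)))
      (N 2 (N 5 (N 6 (N 4 L L) (N 1 L L)) (N 1 L L))
           (N 4 (N 5 (N 1 (N 6 (N 8 L L) (N 8 L L)) (N 6 L L)) (N 3 (N 6 L L) L))
                (N 3 (N 6 L L) L))).

Lemma family_decomposes : decomposes 10 4 family_tree family_gens.
Proof. by vm_compute. Qed.

Fixpoint bitseqs (m : nat) : seq bitseq :=
  if m is m'.+1 then [seq b :: s | b <- [:: true; false], s <- bitseqs m'] else [:: [::]].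

Lemma mem_bitseqs s : s \in bitseqs (size s).
Proof.
elim: s => // b s IH; apply: (allpairs_f cons) IH.
by case: b.
Qed.

Definition union_with (p : nat) (b : bitseq) : bitseq :=
  mkseq (fun u => in_family u p || nth false b u) 9.

Definition union_code (ps : seq nat) : bitseq := foldr union_with (nseq 9 false) ps.

Lemma nth_union_code ps u : nth false (union_code ps) u = has (in_family u) ps && (u < 9)%N.
Proof.
have [ltu|geu] := ltnP u 9; last first.
  by rewrite andbF nth_default //; case: ps => [|p ps]; rewrite /= ?size_nseq ?size_mkseq.
rewrite andbT; elim: ps => [|p ps IH].
  by rewrite -[union_code [::]]/(nseq 9 false) nth_nseq if_same.
by rewrite [LHS]nth_mkseq // IH.
Qed.

Definition face_mask (b : bitseq) : bitseq := [seq code_sub a b | a <- codes].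

Lemma in_maskE (W F : {set vertex}) :
  in_mask (face_mask (encode W)) F = (encode F \in codes) && (F \subset W).
Proof.
rewrite /in_mask /index_face; case: (boolP (encode F \in codes)) => Fc.
  by rewrite (nth_map [::]) ?index_mem // nth_index //= code_subE.
by rewrite nth_default // size_map memNindex.
Qed.

(* the unions b of sets V_p, each with a sequence of elementary collapses to the
   void complex of the faces that do not meet b *)
Definition union_table : seq (bitseq * seq (nat * nat)) := Eval vm_compute in
  [seq (b, find_collapse 18 (face_mask (map negb b)))
  | b <- undup [seq union_code (mask s (iota 0 10)) | s <- bitseqs 10]].

(** Closure under adding one V_p lets membership of an arbitrary union be proved by induction on its
    list of indices. *)
Lemma union_table_closed :
  let keys := unzip1 union_table in
  (nseq 9 false \in keys) &&
  all (fun b => all (fun p => union_with p b \in keys) (iota 0 10)) keys.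
Proof. by vm_compute. Qed.

(** The exempt case is a union covering all vertices: only the empty face is left, which does not
    collapse to the void complex and is treated by [strand_exact_empty]. *)
Lemma union_table_collapses :
  all (fun bp : bitseq * seq (nat * nat) => let W := map negb bp.1 in
    ~~ has id W || collapses (face_mask W) bp.2) union_table.
Proof. by vm_compute. Qed.

Lemma mem_union_table ps : all (fun p => p < 10)%N ps ->
  union_code ps \in unzip1 union_table.
Proof.
have /andP[t0 /allP tD] := union_table_closed.
elim: ps => [//|p ps IH] /andP[ltp /IH psT].
by have /allP := tD _ psT; apply; rewrite mem_iota.
Qed.

Lemma tnth_family p : tnth family p = vset (nth [::] family_lists p).
Proof.
rewrite (tnth_nth set0) -[family : seq _]/[seq vset l | l <- family_lists].
by rewrite (nth_map [::]).
Qed.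

Definition fam_label : labelling 10 := family_labelling family.

Lemma fam_labelE u p : fam_label u p = in_family u p.
Proof. by rewrite mnmE tnth_family inE. Qed.

Lemma fam_label_le u (n : 'X_{1..10}) :
  (fam_label u <= n)%MM = ~~ has (in_family u) [seq p <- iota 0 10 | nth 0%N n p == 0%N].
Proof.
apply/mnm_lepP/hasPn => [H p|H p].
  rewrite mem_filter mem_iota => /andP[/eqP np /= ltp].
  by have := H (Ordinal ltp); rewrite fam_labelE (mnm_nth 0%N) np; case: in_family.
rewrite fam_labelE; case up: (in_family u p) => //.
rewrite lt0n; apply/negP => np.
have /H : (p : nat) \in [seq p <- iota 0 10 | nth 0%N n p == 0%N].
  by rewrite mem_filter mem_iota -mnm_nth np ltn_ord.
by rewrite up.
Qed.

Lemma encode_fam_le (n : 'X_{1..10}) :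
  let ps := [seq p <- iota 0 10 | nth 0%N n p == 0%N] in
  encode [set u | (fam_label u <= n)%MM] = map negb (union_code ps).
Proof.
move=> ps; have sU : size (union_code ps) = 9 by case: (ps) => [|p qs]; rewrite /= ?size_mkseq.
apply: (@eq_from_nth _ false) => [|u]; rewrite size_mkseq ?[RHS]size_map // => ltu.
rewrite (nth_encode _ (Ordinal ltu)) inE fam_label_le (nth_map false) ?sU //.
by rewrite nth_union_code ltu andbT.
Qed.

(** * The family is an object of the category *)

Section FamilyObject.
Variables (k : fieldType) (sgn : {set vertex} -> {set vertex} -> int).
Hypothesis sgn_incidence : incidence_function sgn.

Lemma fam_strand_exact i n : @strand_exact k sgn 10 fam_label i n.
Proof.
pose ps := [seq p <- iota 0 10 | nth 0%N n p == 0%N].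
have : union_code ps \in unzip1 union_table.
  apply: mem_union_table; apply/allP => p.
  by rewrite mem_filter mem_iota => /andP[_ /andP[]].
case/mapP => -[b cs] bT /= bE; have := allP union_table_collapses _ bT.
rewrite /= -bE -encode_fam_le; case/orP => [/hasPn none|cl].
  apply: strand_exact_empty => // u; apply/negP => un.
  have /none : true \in encode [set v | (fam_label v <= n)%MM]; last by [].
  apply/(nthP false); exists u; first by rewrite size_mkseq.
  by rewrite nth_encode inE.
apply: strand_exact_of_acyclic => //.
apply: (eq_acyclic _ (collapses_acyclic sgn_incidence cl)) => F.
rewrite in_maskE face_label_le; congr (_ && _).
by apply/subsetP/forall_inP => H u /H; rewrite inE.
Qed.

Lemma fam_free_resolution : free_resolution k sgn fam_label.
Proof.
split=> [z0|i z]; first exact: cell_diff_vertices.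
by apply: exact_of_strands => // n; apply: fam_strand_exact.
Qed.

Lemma fam_facets_differ : all (fun g => all (fun f => facet_code g f ==>
  has (fun p => has (fun u => nth false f u && in_family u p) (iota 0 9) &&
    ~~ has (fun u => nth false g u && in_family u p) (iota 0 9)) (iota 0 10)) codes) codes.
Proof. by vm_compute. Qed.

Lemma fam_label_facet G F : is_facet G F ->
  exists p, face_label fam_label G p != face_label fam_label F p.
Proof.
move=> GF; have /existsP [i /and3P[Gi Fi _]] := GF; rewrite !facesE in Gi Fi.
have {}Gi : encode G \in codes := face_codes_all Gi.
have {}Fi : encode F \in codes := face_codes_all Fi.
have := implyP (allrelP fam_facets_differ _ _ Gi Fi).
rewrite -is_facetE => check; case/hasP: (check GF) => p; rewrite mem_iota => /andP[_ ltp].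
case/andP => /hasP [u]; rewrite mem_iota => /andP[_ ltu] /andP[uF up] /hasPn Gp.
pose p' : 'I_10 := Ordinal ltp; exists p'.
rewrite (nth_encode _ (Ordinal ltu)) in uF.
have /mnm_lepP/(_ p') := label_le_face fam_label uF.
rewrite fam_labelE up => Fp.
(* No vertex of G lies in V_p, so every vertex label of G still divides e, whose exponent at p is 0.
   Hence x_p does not divide the label of G. *)
pose e := [multinom (if q == p' then 0 else face_label fam_label G q)%N | q < 10].
have /mnm_lepP/(_ p') : (face_label fam_label G <= e)%MM.
  rewrite face_label_le; apply/forall_inP => v vG; apply/mnm_lepP => q.
  rewrite [e q]mnmE; case: (q =P p') => [->|_]; last by have /mnm_lepP := label_le_face fam_label vG.
  have := Gp v; rewrite mem_iota ltn_ord nth_encode vG => /(_ isT) /= vp.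
  by rewrite fam_labelE (negbTE vp).
rewrite [e p']mnmE eqxx leqn0 => /eqP ->.
by rewrite eq_sym -lt0n.
Qed.

Lemma fam_minimal : minimal_differentials k sgn fam_label.
Proof.
move=> i z G; rewrite ffunE; have iS := @span_ideal_ideal {mpoly k[10]} _ (fun p : 'I_10 => 'X_p).
apply: ideal_sum => // F GF; apply: idealMr => //.
have [p np] := fam_label_facet GF.
have /mnm_lepP/(_ p) le := face_labelS fam_label (is_facet_sub GF).
set m := (_ - _)%MM; have pm : (U_(p) <= m)%MM.
  by rewrite lep1mP mnmBE subn_eq0 -ltnNge ltn_neqAle np.
rewrite -(submK pm) mpolyXD mulrA; case: (iS) => _ _; apply.
exact: (span_ideal_gen (fun p : 'I_10 => 'X_p)).
Qed.

Lemma fam_label_ideal : @label_ideal k 10 fam_label = monomial_ideal (covered family_gens (n := 10)).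
Proof.
apply: functional_extensionality => f; apply: propositional_extensionality.
rewrite label_idealE; apply: eq_monomial_ideal => m.
apply/existsP/hasP => [[u]|[g /mapP [u]]].
  rewrite fam_label_le => /hasPn H.
  exists [seq p <- iota 0 10 | in_family u p].
    apply: (map_f (fun v => [seq p <- iota 0 10 | in_family v p])).
    by rewrite mem_iota ltn_ord.
  apply/allP => p; rewrite mem_filter => /andP[up pI]; apply/negP => mp.
  by have := H p; rewrite mem_filter mp pI up => /(_ isT).
rewrite mem_iota => /andP[_ ltu] -> /allP H; exists (Ordinal ltu).
rewrite fam_label_le; apply/hasPn => p; rewrite mem_filter => /andP[mp pI].
by apply/negP => up; have := H p; rewrite mem_filter up pI mp => /(_ isT).
Qed.

Lemma fam_antichain u v : u != v -> ~~ (fam_label u <= fam_label v)%MM.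
Proof.
have check : all (fun u => all (fun v => (u != v) ==>
    has (fun p => in_family u p && ~~ in_family v p) (iota 0 10)) (iota 0 9)) (iota 0 9).
  by vm_compute.
have ord9 (w : vertex) : (w : nat) \in iota 0 9 by rewrite mem_iota ltn_ord.
move=> uv; have := implyP (allrelP check _ _ (ord9 u) (ord9 v)) uv.
case/hasP => p; rewrite mem_iota => /andP[_ ltp] /andP[up vp].
apply/negP => /mnm_lepP /(_ (Ordinal ltp)).
by rewrite !fam_labelE up (negbTE vp).
Qed.

Lemma fam_CM_object : CM_object k sgn fam_label.
Proof.
split; first exact: fam_antichain.
- by rewrite fam_label_ideal; apply: decomposes_cohen_macaulay family_decomposes.
- by rewrite fam_label_ideal; apply: decomposes_codim family_decomposes.
- exact: fam_free_resolution.
- exact: fam_minimal.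
Qed.

Lemma fam_var_support p : var_support fam_label p = tnth family p.
Proof. by apply/setP => u; rewrite inE lep1mP fam_labelE tnth_family inE eqb0 negbK. Qed.

Lemma fam_CM_star_object : CM_star_object k sgn fam_label.
Proof.
split; first exact: fam_CM_object.
  by move=> u p; rewrite fam_labelE; case: in_family.
have uniq_codes : uniq [seq code l | l <- family_lists] by vm_compute.
move=> p q; rewrite !fam_var_support !tnth_family => /(congr1 encode).
rewrite !encode_vset => E; apply/val_inj/eqP.
have lt10 (x : 'I_10) : (val x < size family_lists)%N by apply: ltn_ord.
rewrite -(nth_uniq [::] _ _ uniq_codes) ?size_map ?lt10 //.
by rewrite !(nth_map [::]) ?lt10 //; apply/eqP.
Qed.

End FamilyObject.

(** * Obstructions to acyclicity *)

Section Obstructions.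
Variables (k : fieldType) (sgn : {set vertex} -> {set vertex} -> int).
Hypothesis sgn_incidence : incidence_function sgn.

Lemma facet_vertex u F : F \in faces 2 -> is_facet [set u] F = (u \in F).
Proof.
move=> F2; apply/existsP/idP => [[i /and3P[_ _]]|uF]; first by rewrite sub1set.
by exists (inord 1); rewrite inordK // F2 sub1set uF !andbT; apply/imsetP; exists u.
Qed.

Lemma sum_sgn_edge F : F \in faces 2 -> \sum_(u in F) sgn [set u] F = 0.
Proof.
move=> F2; have [_ _ s1 s2] := sgn_incidence.
have E0 : set0 \in faces 0 by rewrite inE.
rewrite -[RHS](s2 0%N set0 F E0 F2 (sub0set F)).
rewrite (eq_bigl (fun G => G \in [set [set u] | u in F])) => [|G].
  rewrite big_imset /=; last by move=> u v _ _; apply: set1_inj.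
  by apply: eq_bigr => u _; rewrite s1 mul1r.
apply/andP/imsetP => [[G0 GF]|[u uF ->]].
  have : G \in faces 1 by apply: is_facet_cofaces G0 _; rewrite inE.
  by case/imsetP => u _ E; exists u => //; rewrite -(facet_vertex u F2) -E.
rewrite facet_vertex //; split=> //.
apply/existsP; exists ord0; rewrite inE eqxx sub0set andbT /=.
by apply/imsetP; exists u.
Qed.

Variables (s : nat) (b : labelling s) (n : 'X_{1..s}).

(** The cycle [u] - [v] bounds a chain of edges. Summing the coefficients of its boundary over X
    gives 1, while an edge inside X or disjoint from X contributes 0. *)
Lemma strand_connected (X : {set vertex}) u v :
  strand_exact k sgn b 0 n ->
  (b u <= n)%MM -> (b v <= n)%MM -> u \in X -> v \notin X ->
  exists F, [/\ F \in faces 2, forall x, x \in F -> (b x <= n)%MM,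
    ~~ (F \subset X) & ~~ [disjoint F & X]].
Proof.
move=> ex un vn uX vX; apply: NNPP => none.
have uv : u != v by apply: contraNneq vX => <-.
pose c F : k := (F == [set u])%:R - (F == [set v])%:R.
have [F|G|w [supw dw]] := ex c.
- rewrite /c => cF; have [x -> xn] : exists2 x, F = [set x] & (b x <= n)%MM.
    case: (F =P [set u]) cF => [->|_]; first by exists u.
    by case: (F =P [set v]) => [->|_]; [exists v|rewrite subrr eqxx].
  by rewrite face_label_vertex; split=> //; apply/imsetP; exists x.
- transitivity ((sgn G [set u])%:~R - (sgn G [set v])%:~R : k).
    rewrite /boundary (bigD1 [set u]) //= (bigD1 [set v]) /=; last first.
      by rewrite (inj_eq set1_inj) eq_sym.
    rewrite big1 => [|F /andP[Fu Fv]]; last first.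
      by rewrite /c (negbTE Fu) (negbTE Fv) subrr mulr0.
    rewrite /c !eqxx !(inj_eq set1_inj) (eq_sym v u) (negbTE uv).
    by rewrite subr0 sub0r addr0 mulr1 mulrN1.
  have [_ s0 s1 _] := sgn_incidence; have [->|G0] := eqVneq G set0.
    by rewrite !s1 subrr.
  have nf x : ~~ is_facet G [set x].
    apply: contra G0 => Gx; have : G \in faces 0.
      by apply: is_facet_faces Gx _; apply/imsetP; exists x.
    by rewrite inE.
  by rewrite !s0 ?nf // subrr.
have : \sum_(x in X) boundary sgn w [set x] = 1.
  under eq_bigr => x _ do rewrite dw.
  rewrite (bigD1 u) //= /c eqxx (inj_eq set1_inj) (negbTE uv) subr0.
  rewrite big1 ?addr0 // => x /andP[xX xu]; rewrite !(inj_eq set1_inj) (negbTE xu).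
  by have -> : x == v = false; [apply: contraNF vX => /eqP <-|rewrite subrr].
rewrite /boundary exchange_big big1 /= => [/esym/eqP|F _]; first by rewrite oner_eq0.
rewrite -mulr_suml; have [->|wF] := eqVneq (w F) 0; first by rewrite mulr0.
have [F2 Fn] := supw F wF; rewrite face_label_le in Fn.
suff -> : \sum_(x in X) (sgn [set x] F)%:~R = 0 :> k by rewrite mul0r.
have sgn0 x : x \notin F -> (sgn [set x] F)%:~R = 0 :> k.
  move=> xF; apply/eqP; apply: contraNT xF.
  by move/(sgn_facet sgn_incidence); rewrite facet_vertex.
case: (boolP (F \subset X)) => FX.
  rewrite -[RHS](_ : (\sum_(x in F) sgn [set x] F)%:~R = 0); last by rewrite sum_sgn_edge.
  rewrite rmorph_sum /= (bigID (mem F)) /= [X in _ + X]big1 ?addr0; last first.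
    by move=> x /andP[_ /sgn0].
  apply: eq_bigl => x; rewrite andb_idl //; exact: (subsetP FX).
case: (boolP [disjoint F & X]) => [FdX|nFX]; last first.
  by exfalso; apply: none; exists F; split=> // x xF; apply: (forall_inP Fn).
by apply: big1 => x xX; apply: sgn0; rewrite (disjointFl FdX).
Qed.

Definition pentagon : seq (nat * nat) := [:: (1, 2); (2, 4); (4, 5); (5, 8); (8, 1)]%N.

(** The pentagon is a cycle, and no polygonal face of P has all its vertices among these five, so a
    chain filling it could only be 0. *)
Lemma strand_pentagon :
  strand_exact k sgn b 1 n -> encode [set u | (b u <= n)%MM] <> code [:: 1; 2; 4; 5; 8]%N.
Proof.
move=> ex W.
have Wn (u : vertex) : (b u <= n)%MM = ((u : nat) \in [:: 1; 2; 4; 5; 8]%N).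
  have := nth_encode [set u | (b u <= n)%MM] u.
  by rewrite inE W nth_mkseq // => <-.
pose e (xy : nat * nat) := vset [:: xy.1; xy.2].
(* This sign orients the edge from xy.1 to xy.2, so that the boundary terms cancel around the
   pentagon. *)
pose t (xy : nat * nat) : k := (sgn [set inord xy.2] (e xy))%:~R.
have eE xy : xy \in pentagon -> e xy \in faces 2.
  move=> xyP; rewrite facesE encode_vset.
  have check : all (fun xy => code [:: xy.1; xy.2] \in face_codes 2) pentagon by vm_compute.
  exact: (allP check).
have sgnE u xy : xy \in pentagon ->
    (sgn [set u] (e xy))%:~R * t xy = ((u : nat) == xy.2)%:R - ((u : nat) == xy.1)%:R :> k.
  move=> xyP; have F2 := eE _ xyP.
  have /and3P[lt1 lt2 ne] : [&& (xy.1 < 9)%N, (xy.2 < 9)%N & xy.1 != xy.2].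
    have check : all (fun xy => [&& (xy.1 < 9)%N, (xy.2 < 9)%N & xy.1 != xy.2]) pentagon by [].
    exact: (allP check).
  have eEs : e xy = [set Ordinal lt1; Ordinal lt2].
    by apply/setP => x; rewrite !inE.
  have tE : t xy = (sgn [set Ordinal lt2] (e xy))%:~R.
    by rewrite /t; congr (sgn [set _] _)%:~R; apply/val_inj; rewrite /= inordK.
  have f2 : is_facet [set Ordinal lt2] (e xy) by rewrite facet_vertex // eEs !inE eqxx orbT.
  have := sum_sgn_edge F2; rewrite {1}eEs big_setU1 ?big_set1 /=; last by rewrite inE -val_eqE.
  move=> /(congr1 (fun z : int => z%:~R : k)); rewrite rmorphD /= => /eqP.
  rewrite addr_eq0 -tE => /eqP sum0.
  have [u2|u2] := eqVneq (u : nat) xy.2.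
    have -> : u = Ordinal lt2 by apply/val_inj.
    by rewrite /= eq_sym (negbTE ne) subr0 -tE tE sgn_sqr.
  have [u1|u1] := eqVneq (u : nat) xy.1.
    have -> : u = Ordinal lt1 by apply/val_inj.
    by rewrite sum0 mulNr sub0r tE sgn_sqr.
  rewrite subrr; have [_ s0 _ _] := sgn_incidence.
  by rewrite s0 ?mul0r // facet_vertex // eEs !inE -!val_eqE /= (negbTE u1) (negbTE u2).
pose c F : k := \sum_(xy <- pentagon) (F == e xy)%:R * t xy.
have bdc G : boundary sgn c G = \sum_(xy <- pentagon) (sgn G (e xy))%:~R * t xy.
  rewrite /boundary /c; under eq_bigr => F _ do rewrite mulr_sumr.
  rewrite exchange_big /=; apply: eq_bigr => xy _; rewrite (bigD1 (e xy)) //= eqxx mul1r.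
  by rewrite big1 ?addr0 // => F /negbTE ->; rewrite mul0r mulr0.
have [F|G|w [supw dw]] := ex c.
- move=> cF; have /hasP [xy xyP /eqP ->] : has (fun xy => F == e xy) pentagon.
    apply: contraNT cF => /hasPn H; rewrite /c big_seq big1 // => xy /H /negbTE ->.
    by rewrite mul0r.
  split; first exact: eE.
  rewrite face_label_le; apply/forall_inP => u; rewrite inE Wn => ue.
  have check : all (fun xy => all (fun u => u \in [:: 1; 2; 4; 5; 8]%N) [:: xy.1; xy.2]) pentagon by [].
  exact: (allP (allP check _ xyP)).
- rewrite bdc; case: (boolP (G \in faces 1)) => [/imsetP [u _ ->]|G1].
    rewrite big_seq (eq_bigr _ (sgnE u)) -big_seq /pentagon !big_cons big_nil /=.
    by ring.
  rewrite big_seq big1 // => xy xyP; have [_ s0 _ _] := sgn_incidence.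
  by rewrite s0 ?mul0r //; apply: contra G1 => Gf; apply: is_facet_faces Gf (eE _ xyP).
have w0 F : w F = 0.
  apply/eqP; apply: contraT => /supw [F3]; rewrite face_label_le => /forall_inP Fn.
  have check : all (fun a => ~~ code_sub a (code [:: 1; 2; 4; 5; 8]%N)) (face_codes 3) by vm_compute.
  have := allP check (encode F); rewrite -facesE => /(_ F3); rewrite -W -code_subE.
  by case/negP; apply/subsetP => u /Fn; rewrite inE.
have := dw (e (1, 2)%N); rewrite (eq_boundary _ _ w0) boundary0 /c.
have e_eq xy xy' : (e xy == e xy') = (code [:: xy.1; xy.2] == code [:: xy'.1; xy'.2]).
  by rewrite -(inj_eq encode_inj) !encode_vset.
rewrite /pentagon !big_cons big_nil !e_eq /= mul1r !mul0r !addr0 => /esym t0.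
have := sgnE (inord 2) (1, 2)%N isT; rewrite t0 mulr0 inordK //= subr0 => /esym/eqP.
by rewrite oner_eq0.
Qed.

End Obstructions.

(* W (as a bit list) induces a disconnected subcomplex, X being a union of
   components, or the boundary of a pentagon *)
Definition obstructed (W X : bitseq) : bool :=
  (W == code [:: 1; 2; 4; 5; 8]%N) ||
  [&& has (fun u => nth false W u && nth false X u) (iota 0 9),
      has (fun u => nth false W u && ~~ nth false X u) (iota 0 9) &
      all (fun e => code_sub e W ==> (code_sub e X ||
        all (fun u => ~~ (nth false e u && nth false X u)) (iota 0 9))) edge_codes].

Definition or_code (a c : bitseq) : bitseq :=
  mkseq (fun u => nth false a u || nth false c u) 9.

(** Grown in five rounds from the first vertex of W; the result is a candidate that [excluded] then
    tests. *)
Definition component (W : bitseq) : bitseq :=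
  let step X := mkseq (fun u => nth false X u ||
    has (fun e => [&& nth false e u, code_sub e W &
      has (fun v => nth false e v && nth false X v) (iota 0 9)]) edge_codes) 9 in
  iter 5 step (code [:: find id W]).

(** At most two members: together with the variable under study they make three, fewer than the
    codimension 4. *)
Definition small_index_sets : seq (seq nat) :=
  [::] :: [seq [:: p] | p <- iota 0 10] ++ [seq [:: p; q] | p <- iota 0 10, q <- iota 0 p].

Definition family_codes : seq bitseq := Eval vm_compute in map code family_lists.

Definition excluded (V : bitseq) (ps : seq nat) (X : bitseq) : bool :=
  let U := or_code V (union_code ps) in
  obstructed (map negb U) X || all id U.

Definition find_witness (V : bitseq) : seq nat * bitseq :=
  let X ps := component (map negb (or_code V (union_code ps))) in
  let ps := nth [::] small_index_sets
    (find (fun ps => excluded V ps (X ps)) small_index_sets) in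
  (ps, X ps).

Definition witness_table : seq (bitseq * (seq nat * bitseq)) := Eval vm_compute in
  [seq (V, find_witness V) | V <- bitseqs 9 & has id V && (V \notin family_codes)].

Lemma witness_table_correct :
  all (fun Vw : bitseq * (seq nat * bitseq) => let: (V, (ps, X)) := Vw in
    [&& (size ps <= 2)%N, all (fun p => p < 10)%N ps & excluded V ps X]) witness_table.
Proof. by vm_compute. Qed.

Lemma witness_table_complete :
  all (fun V => [|| ~~ has id V, V \in family_codes | V \in unzip1 witness_table]) (bitseqs 9).
Proof. by vm_compute. Qed.

(** * Maximality *)

(** Otherwise the variables of T would generate a prime of height below c that contains the label
    ideal. *)
Lemma codim_no_cover (k : fieldType) r (b : labelling r) c (T : {set 'I_r}) :
  has_codim (@label_ideal k r b) c -> (#|T| < c)%N ->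
  exists u, forall q, q \in T -> b u q = 0%N.
Proof.
move=> [_ codim] ltT; apply: NNPP => no.
have : (c <= #|T|)%N; last by rewrite leqNgt ltT.
apply: (codim (vars_prime T)); first exact: vars_prime_prime; last exact: vars_prime_height.
move=> f /label_idealE If m /If /existsP [u um]; apply: contraT => nT.
case: no; exists u => q qT; apply/eqP; rewrite -leqn0.
move/mnm_lepP/(_ q): um; rewrite (_ : m q = 0%N) //.
by apply/eqP; apply: contraNT nT => mq; apply/exists_inP; exists q.
Qed.

Section Morphism.
Variables (r s : nat) (b : labelling s) (a : labelling r).
Variable phi : 'X_{1..s} -> 'X_{1..r}.
Hypothesis phi_morph : CM_morphism b a phi.

Lemma morphismE m p : phi m p = (\sum_q m q * phi U_(q)%MM p)%N.
Proof.
have [phi0 phiD _] := phi_morph.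
have phiM e j : phi (e *+ j)%MM = (phi e *+ j)%MM.
  by elim: j => [|j IH]; rewrite ?mulm0n // !mulmS phiD IH.
rewrite {1}(multinomUE_id m) (big_morph phi phiD phi0) mnm_sumE.
by apply: eq_bigr => q _; rewrite phiM mulmnE mulnC.
Qed.

Lemma morphism_labelE u p : a u p = (\sum_q b u q * phi U_(q)%MM p)%N.
Proof. by have [_ _ <-] := phi_morph; apply: morphismE. Qed.

End Morphism.

Lemma tnth_family_sub (p q : 'I_10) : tnth family p \subset tnth family q -> p = q.
Proof.
have check : allrel (fun i j => code_sub (code (nth [::] family_lists i))
   (code (nth [::] family_lists j)) ==> (i == j)) (iota 0 10) (iota 0 10) by vm_compute.
have mem (x : 'I_10) : (x : nat) \in iota 0 10 by rewrite mem_iota ltn_ord.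
rewrite !tnth_family code_subE !encode_vset => sub.
by have := allrelP check _ _ (mem p) (mem q); rewrite sub => /eqP/val_inj.
Qed.

Section Maximality.
Variables (k : fieldType) (sgn : {set vertex} -> {set vertex} -> int).
Hypothesis sgn_incidence : incidence_function sgn.
Variables (s : nat) (b : labelling s) (phi : 'X_{1..s} -> 'X_{1..10}).
Hypothesis b_CM : CM_object k sgn b.
Hypothesis phi_morph : CM_morphism b fam_label phi.

Local Notation img q p := (phi U_(q)%MM p).
Implicit Types (u v : vertex) (p : 'I_10) (q : 'I_s).

Lemma b_strand_exact i n : strand_exact k sgn b i n.
Proof.
have [_ _ _ [_ ex] _] := b_CM; apply: strands_of_exact => // z dz.
exact/ex.
Qed.

Lemma b_codim (T : {set 'I_s}) : (#|T| < 4)%N ->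
  exists u, forall q, q \in T -> b u q = 0%N.
Proof. by have [_ _ codim _ _] := b_CM; apply: codim_no_cover codim. Qed.

Lemma fam_no_cover (T : {set 'I_10}) : (#|T| < 4)%N ->
  exists u : vertex, forall p, p \in T -> ~~ in_family u p.
Proof.
have [_ _ codim _ _] := fam_CM_object k sgn_incidence.
move=> /(codim_no_cover codim) [u Hu]; exists u => p /Hu.
by rewrite fam_labelE => /eqP; rewrite eqb0.
Qed.

Lemma fam_label_sum u p : (in_family u p : nat) = (\sum_q b u q * img q p)%N.
Proof. by rewrite -fam_labelE; apply: morphism_labelE. Qed.

Lemma b_img_family u q p : b u q != 0%N -> img q p != 0%N -> in_family u p.
Proof.
move=> bu np; have := fam_label_sum u p; case: in_family => //= /esym/eqP.
by rewrite sum_nat_eq0 => /forallP /(_ q) /=; rewrite muln_eq0 (negbTE bu) (negbTE np).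
Qed.

(** All thresholds d are considered because the labels of b need not be squarefree. *)
Definition level (q : 'I_s) (d : nat) : {set vertex} := [set u | (d < b u q)%N].

(* the degree that excludes exactly the vertices of level q d and of the sets
   V_p for p in ps *)
Definition cut q d (ps : seq nat) : 'X_{1..s} :=
  [multinom (if [exists p : 'I_10, ((p : nat) \in ps) && (img t p != 0)%N] then 0
             else if t == q then d else \sum_u b u t)%N | t < s].

(** As phi carries b_u to the label of u in the family, u lies in V_p exactly if b_u involves a
    variable t whose image involves x_p; exponent 0 at all such t removes V_p. For the other
    variables except q, the sum of all exponents imposes no bound. *)
Lemma cut_le u q d ps : all (fun p : nat => p < 10)%N ps ->
  (b u <= cut q d ps)%MM = ~~ ((u \in level q d) || has (in_family u) ps).
Proof.
move=> /allP ps10; rewrite negb_or; apply/mnm_lepP/andP => [H|[nV /hasPn nps] t].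
  split.
    rewrite inE -leqNgt; have := H q; rewrite mnmE eqxx.
    by case: ifP => // _ /leq_trans; apply.
  apply/hasPn => p pps; apply/negP => up.
  have := fam_label_sum u (Ordinal (ps10 p pps)); rewrite /= up big1 // => t _.
  apply/eqP; rewrite muln_eq0 orbC; case: eqP => //= np.
  have := H t; rewrite mnmE; case: existsP => [_|[]]; first by rewrite leqn0.
  by exists (Ordinal (ps10 p pps)); rewrite pps; apply/eqP.
rewrite mnmE; case: existsP => [[p /andP[pps np]]|_].
  rewrite leqn0; apply: contraNT (nps p pps) => bu.
  exact: b_img_family bu np.
case: eqP => [->|_]; first by rewrite inE -leqNgt in nV.
by rewrite (bigD1 u) //= leq_addr.
Qed.

Lemma encode_cut q d ps : all (fun p : nat => p < 10)%N ps ->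
  encode [set u | (b u <= cut q d ps)%MM] =
  map negb (or_code (encode (level q d)) (union_code ps)).
Proof.
move=> ps10; apply: (@eq_from_nth _ false) => [|u]; rewrite size_mkseq ?[RHS]size_map // => ltu.
rewrite (nth_encode _ (Ordinal ltu)) inE cut_le // (nth_map false) ?size_mkseq //.
by rewrite nth_mkseq // nth_union_code ltu andbT (nth_encode _ (Ordinal ltu)).
Qed.

Lemma not_obstructed n X : ~~ obstructed (encode [set u | (b u <= n)%MM]) X.
Proof.
apply/negP => /orP[/eqP|/and3P[]].
  by apply: (strand_pentagon sgn_incidence (@b_strand_exact 1%N n)).
case/hasP => u; rewrite mem_iota => /andP[_ ltu].
rewrite (nth_encode _ (Ordinal ltu)) inE => /andP[un uX].
case/hasP => v; rewrite mem_iota => /andP[_ ltv].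
rewrite (nth_encode _ (Ordinal ltv)) inE => /andP[vn vX] /allP edges.
have [|| F [F2 Fn nFX nFdX]] := strand_connected sgn_incidence (X := decode X)
  (@b_strand_exact 0%N n) un vn.
- by rewrite inE.
- by rewrite inE.
have := edges (encode F); rewrite -[edge_codes]/(face_codes 2) -facesE => /(_ F2).
rewrite -code_subE; case: (boolP (F \subset _)) => [_|]; last first.
  by case/negP; apply/subsetP => x /Fn; rewrite inE.
rewrite implyTb /code_sub => /orP[] /allP sub.
  case/negP: nFX; apply/subsetP => x xF; rewrite inE.
  by have := sub x; rewrite mem_iota ltn_ord nth_encode xF => /(_ isT).
case/negP: nFdX; rewrite -setI_eq0; apply/eqP/setP => x; rewrite !inE.
by have := sub x; rewrite mem_iota ltn_ord nth_encode => /(_ isT) /negbTE.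
Qed.

(** The exact strands of b rule out a disconnected or pentagonal complement, so of the alternatives
    in the table only the covering remains. *)
Lemma level_family_or_cover q d : level q d != set0 ->
  (exists p, level q d = tnth family p) \/
  exists T : {set 'I_10}, (#|T| <= 2)%N /\
    forall u, u \in level q d \/ exists2 p, p \in T & in_family u p.
Proof.
move=> V0; set V := level q d in V0 *.
have Vb : encode V \in bitseqs 9 by have := mem_bitseqs (encode V); rewrite size_mkseq.
have := allP witness_table_complete _ Vb; case/or3P => [||/mapP].
- case/set0Pn: V0 => u uV; case/negP; apply/hasP; exists true => //.
  by apply/(nthP false); exists u; rewrite ?size_mkseq ?nth_encode.
- move=> Vf; left; have : encode V \in map code family_lists by [].
  rewrite -mem_map_vset => /(nthP set0) [p]; rewrite size_map => ltp <-.
  exists (Ordinal ltp); rewrite (tnth_nth set0).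
  by congr nth.
case=> -[W [ps X]] wT /= VW; rewrite -{}VW in wT.
have /and3P[sz ps10] := allP witness_table_correct _ wT.
rewrite /excluded -encode_cut // (negbTE (not_obstructed _ _)) orFb => /allP cover.
right; exists [set p : 'I_10 | (p : nat) \in ps]; split.
  apply: leq_trans sz; rewrite card_ord_filter; apply: leq_trans (size_undup ps).
  apply: uniq_leq_size; first exact/filter_uniq/iota_uniq.
  by move=> p; rewrite mem_filter mem_undup => /andP[].
move=> u; have : nth false (or_code (encode V) (union_code ps)) u.
  by apply/cover/mem_nth; rewrite size_mkseq.
rewrite nth_mkseq // nth_encode nth_union_code ltn_ord andbT.
case/orP => [|/hasP [p pps up]]; [by left|right].
by exists (Ordinal (allP ps10 p pps)); rewrite ?inE.
Qed.

(** Here the level lies in V_p, so a covering would give one by three members of the family. The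
    codimension of b is of no help yet, as the V_p are not known to be supports of its variables. If
    the level is a member, it is V_p because no member contains another. *)
Lemma level_family_img q p : level q 0 != set0 -> img q p != 0%N ->
  level q 0 = tnth family p.
Proof.
move=> V0 np; have sub : level q 0 \subset tnth family p.
  apply/subsetP => u; rewrite inE lt0n => bu; rewrite tnth_family inE.
  exact: b_img_family bu np.
have [[p' E]|[T [cT cov]]] := level_family_or_cover V0.
  by rewrite E in sub *; rewrite (tnth_family_sub sub).
have [|u Hu] := fam_no_cover (T := p |: T).
  by rewrite cardsU1; move: cT; case: (p \notin T); lia.
case: (cov u) => [/(subsetP sub)|[p' pT up]].
  by rewrite tnth_family inE; have /negP := Hu p (setU11 _ _).
by have /negP := Hu p' (setU1r _ pT).
Qed.

Lemma family_level p : exists2 q, img q p != 0%N & level q 0 = tnth family p.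
Proof.
have [u up] : exists u : vertex, in_family u p.
  have check : all (fun p : nat => has (in_family^~ p) (iota 0 9)) (iota 0 10) by vm_compute.
  have /hasP [u] := allP check p (etrans (mem_iota 0 10 p) (ltn_ord p)).
  by rewrite mem_iota => /andP[_ ltu] up; exists (Ordinal ltu).
have : (\sum_q b u q * img q p)%N != 0%N by rewrite -fam_label_sum up.
rewrite sum_nat_eq0 negb_forall => /existsP [q] /=.
rewrite muln_eq0 negb_or => /andP[bu np]; exists q => //.
by apply: level_family_img => //; apply/set0Pn; exists u; rewrite inE lt0n.
Qed.

(** By [family_level] each V_p in a covering can be replaced by a variable of b with that support.
    With q these are at most three variables meeting every label of b. *)
Lemma level_family q d : level q d != set0 -> exists p, level q d = tnth family p.
Proof.
move=> V0; have [//|[T [cT cov]]] := level_family_or_cover V0; exfalso.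
have /fin_all_exists [f Hf] : forall p, exists t, level t 0 = tnth family p.
  by move=> p; have [t _ E] := family_level p; exists t.
have [|u Hu] := b_codim (T := q |: f @: T).
  apply: leq_ltn_trans (leq_card_setU _ _) _; rewrite cards1.
  by rewrite add1n !ltnS (leq_trans (leq_imset_card f T) cT).
case: (cov u) => [|[p pT up]]; first by rewrite inE Hu ?setU11.
have : u \in level (f p) 0 by rewrite Hf tnth_family inE.
by rewrite inE Hu // setU1r // imset_f.
Qed.

(** The nonempty levels of q are members of the family contained in V_p, hence all equal to V_p, so
    q has a single nonzero exponent. *)
Lemma column_constant q p u v : level q 0 = tnth family p ->
  in_family u p -> in_family v p -> b u q = b v q.
Proof.
have le (x y : vertex) : level q 0 = tnth family p -> in_family x p -> in_family y p -> (b x q <= b y q)%N.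
  move=> E xp yp; rewrite leqNgt; apply/negP => lt.
  have [p' E'] : exists p', level q (b y q) = tnth family p'.
    by apply: level_family; apply/set0Pn; exists x; rewrite inE.
  have pp : p' = p.
    apply: tnth_family_sub; rewrite -E -E'; apply/subsetP => z; rewrite !inE.
    exact: leq_ltn_trans.
  have : y \in level q (b y q) by rewrite E' pp tnth_family inE.
  by rewrite inE ltnn.
by move=> E up vp; apply/eqP; rewrite eqn_leq !le.
Qed.

Definition chosen (p : 'I_10) : vertex := inord (head 0%N (nth [::] family_lists p)).

Lemma chosen_family p : in_family (chosen p) p.
Proof.
have check : all (fun p : nat => (head 0%N (nth [::] family_lists p) < 9)%N &&
  in_family (head 0%N (nth [::] family_lists p)) p) (iota 0 10) by vm_compute.
have /andP[lt9 fp] := allP check p (etrans (mem_iota 0 10 p) (ltn_ord p)).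
by rewrite /chosen inordK.
Qed.

(** The single nonzero exponent of q if its support is V_p. Thus [section_map] sends x_p to the
    product of the corresponding powers of all variables with support V_p. *)
Definition coefficient (p : 'I_10) (q : 'I_s) : nat :=
  if level q 0 == tnth family p then b (chosen p) q else 0%N.

Definition section_map (m : 'X_{1..10}) : 'X_{1..s} :=
  [multinom (\sum_p m p * coefficient p q)%N | q < s].

Lemma section_label u : section_map (fam_label u) = b u.
Proof.
apply/mnmP => q; rewrite mnmE.
under eq_bigr => p _ do rewrite fam_labelE.
have [V0|V0] := eqVneq (level q 0) set0.
  have b0 v : b v q = 0%N.
    apply/eqP; rewrite -leqn0 leqNgt; have : v \notin level q 0 by rewrite V0 inE.
    by rewrite inE.
  by rewrite b0 big1 // => p _; rewrite /coefficient b0 if_same muln0.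
have [p E] := level_family V0.
rewrite (bigD1 p) //= /coefficient E eqxx big1 ?addn0 => [|p' np]; last first.
  rewrite ifF ?muln0 //; apply: contraNF np => /eqP Ep.
  by apply/eqP/esym/tnth_family_sub; rewrite Ep.
case: (boolP (in_family u p)) => up.
  by rewrite mul1n; apply: column_constant E _ up; apply: chosen_family.
rewrite mul0n; apply/esym/eqP; rewrite -leqn0 leqNgt.
have : u \notin level q 0 by rewrite E tnth_family inE.
by rewrite inE.
Qed.

Lemma section_mapK m : phi (section_map m) = m.
Proof.
apply/mnmP => p; rewrite (morphismE phi_morph).
transitivity (\sum_p' m p' * (\sum_q coefficient p' q * img q p))%N.
  under eq_bigr => q _ do rewrite mnmE big_distrl /=.
  rewrite exchange_big /=; apply: eq_bigr => p' _; rewrite big_distrr /=.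
  by apply: eq_bigr => q _; rewrite mulnA.
have level0 (p' : 'I_10) q : level q 0 = tnth family p' -> level q 0 != set0.
  by move=> ->; apply/set0Pn; exists (chosen p'); rewrite tnth_family inE; apply: chosen_family.
rewrite (bigD1 p) //= [X in (_ + X)%N]big1 ?addn0 => [|p' np].
  (* At the chosen vertex u of V_p, each q whose image involves x_p and which occurs in b_u has
     support V_p, so the sum is the exponent of x_p in the image of b_u, which is 1. *)
  rewrite (_ : \sum_q _ = 1)%N ?muln1 //.
  transitivity (in_family (chosen p) p : nat); last by rewrite chosen_family.
  rewrite fam_label_sum; apply: eq_bigr => q _.
  have [->|nq] := eqVneq (img q p) 0%N; first by rewrite !muln0.
  rewrite /coefficient; case: eqP => // nE; rewrite mul0n; apply/esym/eqP.
  rewrite muln_eq0; apply/orP; left; apply: contraT => bq; case: nE.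
  by apply: level_family_img => //; apply/set0Pn; exists (chosen p); rewrite inE lt0n.
(* A variable contributing here would have both V_p and V_p' as its support. *)
rewrite big1 ?muln0 // => q _; rewrite /coefficient; case: eqP => // E.
have [->|nq] := eqVneq (img q p) 0%N; first by rewrite muln0.
case/eqP: np; apply: tnth_family_sub.
by rewrite -E (level_family_img (level0 _ _ E) nq).
Qed.

Lemma section_morphism : CM_morphism fam_label b section_map.
Proof.
split; last exact: section_label.
  by apply/mnmP => q; rewrite mnmE mnm0E big1 // => p _; rewrite mnm0E.
move=> m n; apply/mnmP => q; rewrite mnmDE !mnmE -big_split.
by apply: eq_bigr => p _; rewrite mnmDE mulnDl.
Qed.

End Maximality.

Theorem proposition4p9 (k : fieldType)
    (sgn : {set vertex} -> {set vertex} -> int)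
    (sgn_incidence : incidence_function sgn) :
  maximal_family k sgn
    [tuple vset [:: 0; 1; 2]; vset [:: 2; 3; 4]; vset [:: 4; 5; 6];
           vset [:: 6; 7; 0]; vset [:: vc; 1; 3]; vset [:: vc; 3; 5];
           vset [:: vc; 5; 7]; vset [:: vc; 7; 1]; vset [:: 1; 2; 3];
           vset [:: 3; 4; 5]]%N.
Proof.
split; first exact: fam_CM_star_object.
split=> [|s b phi b_CM phi_morph]; first exact: fam_CM_object.
split=> [m|].
  by exists (section_map b m); apply: (section_mapK sgn_incidence b_CM phi_morph).
exists (section_map b); split; last exact: (section_mapK sgn_incidence b_CM phi_morph).
exact: (section_morphism sgn_incidence b_CM phi_morph).
Qed.
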